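(* Let $\ell\ge r\ge 2$ and suppose that $F$ is an $r$-graph with $v(F)=\ell+1$ satisfying $$\sup\{\lambda(\mathcal G) : \mathcal G \text{ is an } F\text{-free } r\text{-graph that is not } K^r_\ell\text{-colorable}\}<\binom{\ell}{r}\Big/\ell^r .$$ If either $F$ has an isolated vertex or $F\subseteq B(r,\ell+1)$, then the family $\mathcal K^F_{\ell+1}$ is degree-stable with respect to $\mathfrak K^r_\ell$.
   Context: An $r$-graph is a finite $r$-uniform hypergraph $\mathcal H$, identified with its edge set, with vertex set $V(\mathcal H)$ and $v(\mathcal H)=|V(\mathcal H)|$; $\delta(\mathcal H)$ is its minimum vertex degree (the degree of a vertex is the number of edges containing it). For a family $\mathcal F$ of $r$-graphs, $\mathcal H$ is $\mathcal F$-free if it contains no member of $\mathcal F$ as a (not necessarily induced) subgraph ($F$-free means $\{F\}$-free); $\mathrm{ex}(n,\mathcal F)$ is the maximum number of edges of an $\mathcal F$-free $r$-graph on $n$ vertices, and $\pi(\mathcal F)=\lim_{n\to\infty}\mathrm{ex}(n,\mathcal F)/\binom nr$. Lagrangian: for an $r$-graph $\mathcal G$ with vertex set $[m]$, $\lambda(\mathcal G)=\max\{\sum_{E\in\mathcal G}\prod_{i\in E}x_i : x_1,\dots,x_m\ge 0,\ x_1+\dots+x_m=1\}$. (Lagrangians are nonnegative; a supremum over the empty set is read as $0$.) Blowups: $\mathcal H$ is a blowup of an $r$-graph $G$ if there is a map $\psi\colon V(\mathcal H)\to V(G)$ (not necessarily surjective) such that for every $r$-subset $E$ of $V(\mathcal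 H)$ one has $E\in\mathcal H\iff\psi(E)\in G$. Subgraphs of blowups of $G$ are called $G$-colorable. $K^r_\ell$ is the complete $r$-graph on $\ell$ vertices and $\mathfrak K^r_\ell$ is the class of all blowups of $K^r_\ell$. Weak expansions: for an $r$-graph $F$, let $\partial_{r-2}F$ be the graph on $V(F)$ whose edges are the pairs of vertices contained in a common edge of $F$. If $v(F)=\ell+1$, then $\mathcal K^F_{\ell+1}$ is the set of all $r$-graphs of the form $F\cup\{S_{uv} : uv\in\binom{V(F)}{2}\setminus\partial_{r-2}F\}$, where for every pair $uv$ of vertices of $F$ not covered by an edge of $F$, $S_{uv}$ is an $r$-set containing $u$ and $v$ (its other vertices may be arbitrary, inside or outside $V(F)$, and the sets $S_{uv}$ may overlap or coincide). $B(r,\ell+1)$ is the $r$-graph with vertex set $[\ell+1]=\{1,\dots,\ell+1\}$ and edge set $\{[r]\}\cup\{E\subseteq\{2,\dots,\ell+1\} : |E|=r \text{ and } |E\cap\{2,\dots,r\}|\le 1\}$; $F\subseteq B(r,\ell+1)$ means that $F$ is isomorphic to a subgraph of $B(r,\ell+1)$. A family $\mathcal F$ is degree-stable with respect to a class $\mathfrak H$ of $\mathcal F$-free $r$-graphs if there exist $\epsilon>0$ and $N_0$ such that every $\mathcal F$-free $r$-graph $\mathcal H$ on $n\ge N_0$ vertices with $\delta(\mathcal H)\ge(\pi(\mathcal F)/(r-1)!-\epsilon)n^{r-1}$ is a subgraph of some member of $\mathfrak H$. *)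

(* Defs.v *)
From mathcomp Require Import all_boot all_order all_algebra.
From mathcomp Require Import all_classical all_reals all_analysis.
Import Order.TTheory GRing.Theory Num.Theory.
Import numFieldNormedType.Exports.

Set Implicit Arguments.
Unset Strict Implicit.
Unset Printing Implicit Defensive.

Record ugraph (r : nat) := MkUGraph {
  vertex : finType;
  edges : {set {set vertex}};
  edges_uniform : [forall e in edges, #|e| == r]
}.

Lemma uniform_set (r : nat) (V : finType) (P : pred {set V}) :
  [forall e in [set e : {set V} | (#|e| == r) && P e], #|e| == r].
Proof. by apply/forall_inP => e; rewrite inE => /andP[]. Qed.

Definition ugraph_of (r : nat) (V : finType) (P : pred {set V}) : ugraph r :=
  MkUGraph (uniform_set r P).

(* Not necessarily induced, and up to isomorphism: G is isomorphic to a
   subgraph of H. *)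
Definition is_subgraph (r : nat) (G H : ugraph r) : Prop :=
  exists2 f : vertex G -> vertex H,
    injective f & forall e, e \in edges G -> f @: e \in edges H.

(* Families of r-graphs are plain predicates: set (ugraph r) would raise a
   universe inconsistency. *)
Definition family_free (r : nat) (FF : ugraph r -> Prop) (H : ugraph r) :
    Prop :=
  forall G, FF G -> ~ is_subgraph G H.

Definition complete_ugraph (r l : nat) : ugraph r :=
  ugraph_of r (fun _ : {set 'I_l} => true).

Definition is_blowup (r : nat) (G H : ugraph r) : Prop :=
  exists psi : vertex H -> vertex G,
    forall E : {set vertex H}, #|E| = r ->
      (E \in edges H) = (psi @: E \in edges G).

Definition blowup_class (r : nat) (G : ugraph r) : ugraph r -> Prop :=
  fun H => is_blowup G H.

Definition is_colorable (r : nat) (G H : ugraph r) : Prop :=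
  exists2 B : ugraph r, is_blowup G B & is_subgraph H B.

Definition isolated_vertex (r : nat) (H : ugraph r) (v : vertex H) : Prop :=
  forall e, e \in edges H -> v \notin e.

Definition vdegree (r : nat) (H : ugraph r) (v : vertex H) : nat :=
  #|[set e in edges H | v \in e]|.

(* Every degree is at most #|edges H|, so the initial value of the minimum is
   irrelevant as soon as H has a vertex. *)
Definition min_vdegree (r : nat) (H : ugraph r) : nat :=
  \big[minn/#|edges H|]_(v : vertex H) vdegree v.

Definition pair_shadow (r : nat) (H : ugraph r) : {set {set vertex H}} :=
  [set p : {set vertex H} | (#|p| == 2) && [exists e in edges H, p \subset e]].

Definition uncovered_pairs (r : nat) (H : ugraph r) : {set {set vertex H}} :=
  [set p : {set vertex H} | #|p| == 2] :\: pair_shadow H.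

(* F sits in H as its image under iota; the sets S p exhaust the remaining
   edges, and H has no vertex besides those of F and of the sets S p. That each
   S p is an r-set follows from the uniformity of H. *)
Definition weak_expansions (r : nat) (F : ugraph r) : ugraph r -> Prop :=
  fun H =>
    exists (iota : vertex F -> vertex H) (S : {set vertex F} -> {set vertex H}),
      [/\ injective iota,
          forall p, p \in uncovered_pairs F -> iota @: p \subset S p,
          edges H = [set iota @: e | e : {set vertex F} in edges F]
                    :|: [set S p | p : {set vertex F} in uncovered_pairs F]
        & [set: vertex H] = [set iota v | v : vertex F]
                    :|: \bigcup_(p in uncovered_pairs F) S p].

(* The vertex i of [m] = {1, ..., m} is encoded as i - 1 : 'I_m; thus
   [r] = {i | i < r} and {2, ..., r} = {i | 0 < i < r}.  Since ugraph_of keeps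
   only r-sets, [r] is an edge exactly when r <= m. *)
Definition Bgraph (r m : nat) : ugraph r :=
  ugraph_of r (fun E : {set 'I_m} =>
    (E == [set i : 'I_m | i < r])
    || (E \subset [set i : 'I_m | 0 < i])
       && (#|E :&: [set i : 'I_m | 0 < i < r]| <= 1)).

Definition turan_number (r : nat) (n : nat) (FF : ugraph r -> Prop) : nat :=
  \max_(E : {E : {set {set 'I_n}} | [forall e in E, #|e| == r]}
        | `[< family_free FF (MkUGraph (valP E)) >]) #|val E|.

Local Open Scope ring_scope.

Definition turan_density (R : realType) (r : nat) (FF : ugraph r -> Prop) : R :=
  lim ((fun n => (turan_number n FF)%:R / 'C(n, r)%:R : R) @ \oo)%classic.

(* The supremum is attained, by compactness of the simplex. When G has no vertex
   the simplex is empty and the value is sup set0 = 0. *)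
Definition ugraph_lagrangian (R : realType) (r : nat) (G : ugraph r) : R :=
  sup (fun y : R => exists x : vertex G -> R,
    [/\ forall i, 0 <= x i,
        \sum_i x i = 1
      & y = \sum_(e in edges G) \prod_(i in e) x i]).

Definition degree_stable (R : realType) (r : nat) (FF HH : ugraph r -> Prop) :
    Prop :=
  (forall H, HH H -> family_free FF H) /\
  exists (eps : R) (N0 : nat), 0 < eps /\
    forall H : ugraph r, (N0 <= #|vertex H|)%N -> family_free FF H ->
      (turan_density R FF / (r.-1)`!%:R - eps) * #|vertex H|%:R ^+ r.-1
        <= (min_vdegree H)%:R ->
      exists2 B, HH B & is_subgraph H B.

(* Main.v *)
Require Import Defs.
From mathcomp Require Import all_boot all_order all_algebra all_fingroup.
From mathcomp Require Import ring lra zify.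
Import Order.TTheory GRing.Theory Num.Theory.

(* Copies of F whose vertices are pairwise covered by edges ("cores") are
   exactly what K^F-freeness forbids, and their absence is inherited by
   pullbacks along maps of the vertex set.  Zykov symmetrization, done one
   vertex at a time by modifying a map phi, never decreases the number of edges
   and ends with a blowup of a 2-covering r-graph: either it has at most l
   vertices and the blowup is colorable, or it is F-free and not colorable and
   the Lagrangian gap makes the blowup sparse.  Maclaurin's inequality then
   gives e(H) <= C(l,r) (n/l)^r, hence the Turan density.  For stability the
   symmetrization is run backwards: consecutive graphs differ at one vertex, few
   vertices have low degree, and in a graph of large minimum degree a coloring
   of all vertices but one (and a few discarded ones) extends to that vertex. *)

Set Implicit Arguments.
Unset Strict Implicit.
Unset Printing Implicit Defensive.

(** Plain F-freeness is not inherited by blowups. A core is: two of its vertices always share an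
    edge, so a blowup map never identifies them, and a core in a pullback projects to a core. Graphs
    are therefore never rebuilt; each stage is read off a map [phi] on a fixed vertex set.

    Symmetrization does not preserve the minimum degree. What persists is a lower bound on the
    number of edges, so the claim carried backwards is weaker: a coloring off the vertices of low
    degree. A backward step gives up the modified vertex and the low-degree vertices of both graphs,
    then regains all but the low-degree vertices of the current graph. The loss thus does not
    accumulate over the steps, and the original graph has no vertex of low degree.

    Both alternatives for F enter only through a vertex [a] and a set [T]: every edge through [a]
    equals [a |: T], and every other edge meets [T] at most once. When F is built around a vertex v,
    with [T] placed inside an edge through v, each remaining edge of F uses at most one vertex
    foreign to a complete transversal system. *)

Lemma ex_subset_card (T : finType) (A B : {set T}) k :
  A \subset B -> #|A| <= k <= #|B| ->
  exists2 C : {set T}, A \subset C & (C \subset B) && (#|C| == k).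
Proof.
move=> sAB /andP[]; elim: k => [|k IHk] leAk lekB.
  by exists A => //; rewrite sAB -leqn0.
have [eqA|neA] := eqVneq #|A| k.+1; first by exists A => //; rewrite sAB eqA eqxx.
have [|C sAC /andP[sCB /eqP cC]] := IHk _ (ltnW lekB).
  by rewrite -ltnS ltn_neqAle neA.
have /card_gt0P[x] : 0 < #|B :\: C| by rewrite cardsDS // cC subn_gt0.
rewrite inE => /andP[xC xB].
exists (x |: C); first by rewrite subsetU // sAC orbT.
by rewrite subUset sub1set xB sCB cardsU1 xC cC add1n eqxx.
Qed.

(** Enumerations of [A] and [Y] that begin with [T] and [J] are matched position by position. In the
    applications [A] is the set of vertices of F other than the pivot and [Y] the set of colors. *)
Lemma ex_inj_imset (X Y : finType) (y0 : Y) (A T : {set X}) (J : {set Y}) :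
  T \subset A -> #|T| = #|J| -> #|A| <= #|Y| ->
  exists2 c : X -> Y, {in A &, injective c} & c @: T = J.
Proof.
move=> sTA cTJ leAY.
pose sX := enum T ++ enum (A :\: T); pose sY := enum J ++ enum (~: J).
have uX : uniq sX.
  rewrite cat_uniq !enum_uniq andbT /=; apply/hasPn => x.
  by rewrite !mem_enum inE => /andP[].
have uY : uniq sY.
  rewrite cat_uniq !enum_uniq andbT /=; apply/hasPn => x.
  by rewrite !mem_enum inE.
have szX : size sX = #|A| by rewrite size_cat -!cardE cardsDS // subnKC ?subset_leq_card.
have szY : size sY = #|Y| by rewrite size_cat -!cardE cardsC.
have memX x : (x \in sX) = (x \in A).
  rewrite mem_cat !mem_enum inE; have [xT|//] := boolP (x \in T).
  by rewrite (subsetP sTA).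
have idx x : x \in A -> index x sX < size sY.
  by move=> xA; rewrite szY (leq_trans _ leAY) // -szX index_mem memX.
exists (fun x => nth y0 sY (index x sX)) => [x y xA yA /eqP|].
  rewrite nth_uniq ?idx // => /eqP exy.
  by rewrite -(nth_index x (s := sX) (x := x)) ?memX // exy nth_index ?memX.
apply/eqP; rewrite eqEcard; apply/andP; split.
  apply/subsetP => _ /imsetP[x xT ->].
  have lt_x : index x (enum T) < size (enum J).
    by rewrite -cardE -cTJ cardE index_mem mem_enum.
  by rewrite index_cat mem_enum xT nth_cat lt_x -mem_enum mem_nth.
rewrite card_in_imset ?cTJ // => x y /(subsetP sTA) xA /(subsetP sTA) yA /eqP.
rewrite nth_uniq ?idx // => /eqP exy.
by rewrite -(nth_index x (s := sX) (x := x)) ?memX // exy nth_index ?memX.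
Qed.

(** A transversal is the image of exactly one choice function on [J]; the constant value [y0]
    outside [J] is what makes that function unique. *)
Lemma card_transversals (T K : finType) (U : {set T}) (chi : T -> K)
    (J : {set K}) :
  #|[set e : {set T} | [&& e \subset U, #|e| == #|J| & chi @: e == J]]| =
  \prod_(k in J) #|[set x in U | chi x == k]|.
Proof.
have [->|/set0Pn[k0 k0J]] := eqVneq J set0.
  rewrite big_set0 cards0 -(cards1 (set0 : {set T})); apply: eq_card => e.
  rewrite !inE cards_eq0; have [->|_] := eqVneq e set0; last by rewrite andbF.
  by rewrite sub0set imset0 eqxx.
have [y0|noT] := pickP (fun _ : T => true); last first.
  rewrite (bigD1 k0) //= [X in X * _]eq_card0 ?mul0n.
    apply: eq_card0 => e; rewrite !inE; apply/negP => /and3P[_ _ /eqP eJ].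
    by move: k0J; rewrite -eJ => /imsetP[x]; have := noT x.
  by move=> x; have := noT x.
pose P k := [set x in U | chi x == k].
transitivity #|[set (f : {ffun K -> T}) @: J | f in pfamily y0 J P]|.
  apply: eq_card => e; rewrite !inE; apply/and3P/imsetP.
    case=> sU /eqP cE /eqP eJ; have chi_inj : {in e &, injective chi}.
      by apply/imset_injP; rewrite eJ cE.
    pose g k := odflt y0 [pick x in e | chi x == k].
    have gP k : k \in J -> g k \in e /\ chi (g k) = k.
      rewrite /g -eJ => /imsetP[x xe ->].
      case: pickP => [y /andP[ye /eqP //]|/(_ x)].
      by rewrite /= xe eqxx.
    exists [ffun k => if k \in J then g k else y0].
      apply/pfamilyP; split.
        by apply/supportP => k /negbTE kJ; rewrite ffunE kJ.
      move=> k kJ; rewrite ffunE kJ inE; have [ge ->] := gP k kJ.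
      by rewrite (subsetP sU) /=.
    apply/eqP; rewrite eq_sym eqEcard; apply/andP; split.
      by apply/subsetP => _ /imsetP[k kJ ->]; rewrite ffunE kJ; case: (gP k kJ).
    rewrite cE card_in_imset // => j k jJ kJ; rewrite !ffunE jJ kJ => ejk.
    by rewrite -(proj2 (gP j jJ)) ejk (proj2 (gP k kJ)).
  case=> f /pfamilyP[_ fP] ->.
  have chif k : k \in J -> chi (f k) = k by move/fP; rewrite inE => /andP[_ /eqP].
  split.
  - by apply/subsetP => _ /imsetP[k kJ ->]; move: (fP k kJ); rewrite inE => /andP[].
  - rewrite card_in_imset // => j k jJ kJ ejk.
    by rewrite -(chif j) // ejk chif.
  - rewrite -imset_comp; apply/eqP/setP => k; apply/imsetP/idP => [[j jJ ->]|kJ].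
      by rewrite /= chif.
    by exists k => //=; rewrite chif.
rewrite card_in_imset; last first.
  move=> f g /pfamilyP[/supportP sf fP] /pfamilyP[/supportP sg gP] efg.
  have chif k : k \in J -> chi (f k) = k by move/fP; rewrite inE => /andP[_ /eqP].
  have chig k : k \in J -> chi (g k) = k by move/gP; rewrite inE => /andP[_ /eqP].
  apply/ffunP => k; have [kJ|kJ] := boolP (k \in J); last by rewrite sf ?sg.
  have /imsetP[j jJ fk] : f k \in g @: J by rewrite -efg imset_f.
  by move: (chif k kJ); rewrite fk chig // => ->.
by rewrite card_pfamily foldrE big_image.
Qed.

Lemma disjoint_setU1r (T : finType) (e W : {set T}) (v : T) :
  [disjoint e & v |: W] = (v \notin e) && [disjoint e & W].
Proof. by rewrite !disjoints_subset setCU subsetI subsetC sub1set inE. Qed.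

(** * Elementary symmetric functions *)

Local Open Scope ring_scope.

Definition elem_sym (R : realFieldType) (K : finType) (x : K -> R) (A : {set K}) (m : nat) : R :=
  \sum_(J : {set K} | (J \subset A) && (#|J| == m)) \prod_(k in J) x k.

Section Maclaurin.

Variables (R : realFieldType) (K : finType) (x : K -> R) (A : {set K}).

Let g (m : nat) i := \sum_(J : {set K} | (J \subset A) && (#|J| == m) && (i \in J))
               \prod_(k in J) x k.

Let sum_g m : \sum_(i in A) g m i = m%:R * elem_sym x A m.
Proof.
rewrite /g (exchange_big_dep (fun J : {set K} => (J \subset A) && (#|J| == m))) /=; last first.
  by move=> i J _ /andP[].
rewrite big_distrr /=; apply: eq_bigr => J /andP[sJA /eqP cJ].
rewrite (eq_bigl (fun i => i \in J)) ?sumr_const ?mulr_natl ?cJ // => i.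
rewrite sJA eqxx /=.
by have [/(subsetP sJA)->|] := boolP (i \in J); rewrite ?andbF.
Qed.

Let sum_mul_elem_sym m :
  (\sum_(i in A) x i) * elem_sym x A m =
  \sum_(i in A) x i * g m i + m.+1%:R * elem_sym x A m.+1.
Proof.
rewrite -sum_g mulr_suml -big_split /=; apply: eq_bigr => i iA.
rewrite /elem_sym (bigID (fun J : {set K} => i \in J)) /= mulrDr; congr (_ + _).
rewrite /g [RHS](reindex_onto (fun J => i |: J) (fun J => J :\ i)) /=; last first.
  by move=> J /andP[_ iJ]; rewrite setD1K.
rewrite big_distrr /=; apply: eq_big => [J|J /andP[_ iJ]]; last by rewrite big_setU1.
rewrite subUset sub1set iA setU11 andbT cardsU1 /=.
have [iJ|iJ] := boolP (i \in J); last by rewrite setU1K // eqxx !andbT add1n eqSS.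
rewrite andbF; apply/esym/negP => /andP[_ /eqP eJ].
by move: iJ; rewrite -eJ setD11.
Qed.

Hypothesis x_ge0 : forall i, 0 <= x i.

(** Terms containing both [i] and [j] contribute the same [b] to [g m i] and [g m j]. The
    transposition of [i] and [j] matches the other terms, so they are [x i * h] and [x j * h] with a
    common [h], and the product is a square times [h]. *)
Let cov_ge0 m i j : i \in A -> j \in A -> 0 <= (x i - x j) * (g m i - g m j).
Proof.
move=> iA jA; have [->|nij] := eqVneq i j; first by rewrite subrr mul0r.
pose Q (J : {set K}) := (J \subset A) && (#|J| == m).
pose h := \sum_(J : {set K} | [&& Q J, i \in J & j \notin J]) \prod_(k in J :\ i) x k.
pose b := \sum_(J : {set K} | [&& Q J, i \in J & j \in J]) \prod_(k in J) x k.
have -> : g m i = b + x i * h.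
  rewrite /g (bigID (fun J : {set K} => j \in J)) /=; congr (_ + _).
    by apply: eq_bigl => J; rewrite -andbA.
  rewrite big_distrr /=; apply: eq_big => [J|J /andP[/andP[_ iJ] _]].
    by rewrite -andbA.
  by rewrite (big_setD1 i).
have -> : g m j = b + x j * h.
  rewrite /g (bigID (fun J : {set K} => i \in J)) /=; congr (_ + _).
    by apply: eq_bigl => J; rewrite -andbA (andbC (j \in J)).
  have tpK : involutive (fun J : {set K} => tperm i j @: J).
    by move=> J; rewrite -imset_comp -[RHS]imset_id; apply: eq_imset => k; exact: tpermK.
  have tA : tperm i j @: A = A.
    apply/eqP; rewrite eqEcard card_imset ?leqnn ?andbT; last exact: perm_inj.
    by apply/subsetP => _ /imsetP[k kA ->]; case: tpermP.
  have mem_t (J : {set K}) k : (k \in tperm i j @: J) = (tperm i j k \in J).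
    by rewrite -{1}[k](tpermK i j) mem_imset //; exact: perm_inj.
  rewrite (reindex_inj (can_inj tpK)) big_distrr /=; apply: eq_big => [J|J].
    rewrite !mem_t tpermL tpermR /Q card_imset; last exact: perm_inj.
    have -> : (tperm i j @: J \subset A) = (J \subset A).
      by apply/idP/idP => /(imsetS (tperm i j)); rewrite ?tpK tA.
    by rewrite -!andbA.
  move=> /andP[/andP[_ ]]; rewrite !mem_t tpermL tpermR => iJ jJ.
  rewrite big_imset /=; last by move=> ? ? _ _; apply: perm_inj.
  rewrite (big_setD1 i) //= tpermL; congr (_ * _); apply: eq_bigr => k.
  rewrite !inE => /andP[ki kJ]; rewrite tpermD // eq_sym //.
  by apply: contraNneq jJ => <-.
rewrite [X in _ * X](_ : _ = (x i - x j) * h); last by ring.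
rewrite mulrA -expr2 mulr_ge0 ?sqr_ge0 //.
by apply: sumr_ge0 => J _; apply: prodr_ge0.
Qed.

Let chebyshev_g m :
  (\sum_(i in A) x i) * (\sum_(i in A) g m i) <=
  #|A|%:R * (\sum_(i in A) x i * g m i).
Proof.
(* Twice the gap is the sum of the nonnegative products of [cov_ge0] over all ordered pairs. *)
rewrite -subr_ge0 -(pmulr_rge0 _ (ltr0Sn R 1)).
suff -> : 2 * (#|A|%:R * (\sum_(i in A) x i * g m i) -
   (\sum_(i in A) x i) * (\sum_(i in A) g m i)) =
   \sum_(i in A) \sum_(j in A) (x i - x j) * (g m i - g m j).
  by apply: sumr_ge0 => i iA; apply: sumr_ge0 => j jA; apply: cov_ge0.
set S := \sum_(i in A) x i * g m i.
have inner i : \sum_(j in A) (x i - x j) * (g m i - g m j) =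
    #|A|%:R * (x i * g m i) + S - (x i * (\sum_(j in A) g m j) + (\sum_(j in A) x j) * g m i).
  rewrite (eq_bigr (fun j => x i * g m i + x j * g m j - (x i * g m j + x j * g m i))).
    by rewrite sumrB !big_split /= sumr_const mulr_natl -mulr_sumr -mulr_suml.
  by move=> j _; ring.
under [RHS]eq_bigr => i _ do rewrite inner.
rewrite sumrB !big_split /= -mulr_sumr -mulr_suml -mulr_sumr sumr_const -/S.
by rewrite -[_ *+ _]mulr_natl; ring.
Qed.

Lemma elem_sym_eq0 m : (#|A| < m)%N -> elem_sym x A m = 0.
Proof.
move=> ltAm; apply: big_pred0 => J; apply/negP => /andP[/subset_leq_card leJ /eqP cJ].
by move: ltAm; rewrite -cJ ltnNge leJ.
Qed.

(* Chebyshev's sum inequality for x i and g m i (the part of the m-th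
   elementary symmetric function divisible by x i) bounds the ratio of
   consecutive elementary symmetric functions. *)
Lemma maclaurin m :
  #|A|%:R ^+ m * elem_sym x A m <= 'C(#|A|, m)%:R * (\sum_(i in A) x i) ^+ m.
Proof.
set s := \sum_(i in A) x i; have s_ge0 : 0 <= s by apply: sumr_ge0.
elim: m => [|m IHm].
  rewrite !expr0 bin0 !mul1r /elem_sym (big_pred1 set0) ?big_set0 // => J /=.
  by rewrite cards_eq0 andbC; case: eqP => // ->; rewrite sub0set.
have [leAm|ltmA] := leqP #|A| m.
  by rewrite elem_sym_eq0 ?ltnS // mulr0 mulr_ge0 ?exprn_ge0 ?ler0n.
rewrite -(ler_pM2l (ltr0Sn R m)).
have -> : m.+1%:R * ('C(#|A|, m.+1)%:R * s ^+ m.+1) =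
    (#|A| - m)%N%:R * s * ('C(#|A|, m)%:R * s ^+ m) :> R.
  by rewrite mulrA -natrM mul_bin_left natrM exprS; ring.
have ratio : #|A|%:R * (m.+1%:R * elem_sym x A m.+1) <= (#|A| - m)%N%:R * s * elem_sym x A m.
  have := chebyshev_g m; have := sum_mul_elem_sym m.
  rewrite -/s sum_g natrB ?(ltnW ltmA) // => /(congr1 ( *%R #|A|%:R)) eq1 le2; lra.
have -> : m.+1%:R * (#|A|%:R ^+ m.+1 * elem_sym x A m.+1) =
   #|A|%:R ^+ m * (#|A|%:R * (m.+1%:R * elem_sym x A m.+1)) by rewrite exprS; ring.
apply: le_trans (ler_wpM2l _ ratio) _; first by rewrite exprn_ge0 ?ler0n.
rewrite mulrCA; apply: ler_wpM2l => //.
by rewrite mulr_ge0 ?ler0n.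
Qed.

Lemma elem_sym_le_const m (c : R) : (forall i, i \in A -> x i <= c) ->
  elem_sym x A m <= 'C(#|A|, m)%:R * c ^+ m.
Proof.
move=> lexc; rewrite -cards_draws -sum1_card natr_sum mulr_suml.
rewrite [X in _ <= X](eq_bigl (fun J : {set K} => (J \subset A) && (#|J| == m))); last first.
  by move=> J; rewrite inE.
apply: ler_sum => J /andP[sJA /eqP <-]; rewrite mul1r -prodr_const.
apply: ler_prod => k kJ; rewrite x_ge0 lexc //; exact: (subsetP sJA).
Qed.

End Maclaurin.

(** * Pullbacks and symmetrization *)

Local Close Scope ring_scope.

(** The blowup of [E] whose fibres are those of [f]: edges of [E] have [r] elements, so the size
    test forces [f] to be injective on each edge. Cloning a vertex amounts to changing one value of
    [f]. *)
Definition pullback (T V : finType) (r : nat) (E : {set {set V}}) (f : T -> V) :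
    {set {set T}} :=
  [set e : {set T} | (#|e| == r) && (f @: e \in E)].

Definition deg (V : finType) (E : {set {set V}}) (x : V) : nat :=
  #|[set e in E | x \in e]|.

Definition covered (V : finType) (E : {set {set V}}) (x y : V) : bool :=
  [exists e in E, (x \in e) && (y \in e)].

(* Since the sets S_uv of a weak expansion are arbitrary, this is equivalent to
   containing no weak expansion of F. *)
Definition core_free (r : nat) (F : ugraph r) (V : finType) (E : {set {set V}}) : Prop :=
  forall g : vertex F -> V, injective g -> (forall e, e \in edges F -> g @: e \in E) ->
  ~ (forall x y, x != y -> covered E (g x) (g y)).

(** [W] holds the vertices still to be colored; [chi] is total, but its values on [W] are never
    consulted. *)
Definition proper (V K : finType) (E : {set {set V}}) (W : {set V}) (chi : V -> K) : Prop :=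
  forall e, e \in E -> [disjoint e & W] -> {in e &, injective chi}.

Definition upd (T : eqType) (Y : Type) (f : T -> Y) (x : T) (y : Y) : T -> Y :=
  fun z => if z == x then y else f z.

Lemma coveredP (V : finType) (E : {set {set V}}) x y :
  reflect (exists2 e, e \in E & (x \in e) && (y \in e)) (covered E x y).
Proof. exact: exists_inP. Qed.

Lemma coveredC (V : finType) (E : {set {set V}}) x y : covered E x y = covered E y x.
Proof. by apply: eq_existsb => e; rewrite [_ && (y \in e)]andbC. Qed.

Lemma pullback_inj (T V : finType) r (E : {set {set V}}) (f : T -> V) e :
  (forall e, e \in E -> #|e| = r) -> e \in pullback r E f -> {in e &, injective f}.
Proof.
by move=> hE; rewrite inE => /andP[/eqP ce fe]; apply/imset_injP; rewrite ce hE.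
Qed.

Lemma pullback_uniform (T V : finType) r (E : {set {set V}}) (f : T -> V) e :
  e \in pullback r E f -> #|e| = r.
Proof. by rewrite inE => /andP[/eqP]. Qed.

Lemma pullback_id (V : finType) r (E : {set {set V}}) :
  (forall e, e \in E -> #|e| = r) -> pullback r E id = E.
Proof.
move=> hE; apply/setP => e; rewrite inE imset_id.
by case eE: (e \in E); rewrite ?andbF // hE // eqxx.
Qed.

Lemma core_free_pullback (r : nat) (F : ugraph r) (T V : finType)
    (E : {set {set V}}) (f : T -> V) :
  (forall e, e \in E -> #|e| = r) -> core_free F E -> core_free F (pullback r E f).
Proof.
move=> hE cfE g gI gE gC; have fgC x y : x != y -> covered E (f (g x)) (f (g y)) /\ f (g x) != f (g y).
  move=> nxy; have /coveredP[e eE /andP[xe ye]] := gC x y nxy.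
  split; last first.
    by apply: contra nxy => /eqP /(pullback_inj hE eE xe ye) /gI ->.
  apply/coveredP; exists (f @: e); first by move: eE; rewrite inE => /andP[].
  by rewrite !imset_f.
apply: (cfE (f \o g)).
- move=> x y /= exy; apply/eqP; apply/negP => /negP /fgC[_].
  by rewrite exy eqxx.
- by move=> e /gE; rewrite inE imset_comp => /andP[].
- by move=> x y /fgC[].
Qed.

Section Symmetrization.

Variables (V : finType) (r : nat) (E : {set {set V}}).

Definition two_covering (phi : V -> V) : Prop :=
  forall x y, phi x != phi y ->
  exists2 e, e \in E & [&& e \subset phi @: setT, phi x \in e & phi y \in e].

(** Making [x] a clone of [y] deletes the edges at [x] and adds a copy, under [tperm x y], of each
    edge at [y]. No edge contains both vertices, since [phi x] and [phi y] are uncovered, so every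
    edge at [y] has such a copy. *)
Lemma symmetrize_ge (phi : V -> V) x y : phi x != phi y ->
  ~~ [exists e in E, [&& e \subset phi @: setT, phi x \in e & phi y \in e]] ->
  (#|pullback r E phi| + deg (pullback r E phi) y <=
   #|pullback r E (upd phi x (phi y))| + deg (pullback r E phi) x)%N.
Proof.
move=> nxy nexy; set D := pullback r E phi; set D' := pullback _ _ _.
have noxy e : e \in D -> y \in e -> x \notin e.
  rewrite inE => /andP[_ eE] ye; apply/negP => xe; case/negP: nexy.
  by apply/exists_inP; exists (phi @: e); rewrite ?imsetS ?imset_f ?subsetT.
have sub1 : [set e in D | x \notin e] \subset [set e in D' | x \notin e].
  apply/subsetP => e; rewrite !inE => /andP[/andP[ce eE] xe]; rewrite ce xe andbT /=.
  rewrite (_ : _ @: e = phi @: e) //; apply: eq_in_imset => z ze.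
  by rewrite /upd; case: eqP ze xe => // -> ->.
have sub2 : (fun e : {set V} => tperm x y @: e) @: [set e in D | y \in e] \subset
    [set e in D' | x \in e].
  apply/subsetP => _ /imsetP[e eDy ->]; move: eDy; rewrite inE => /andP[eD ye].
  have nxe := noxy e eD ye; move: eD; rewrite !inE => /andP[ce eE].
  rewrite card_imset ?(eqP ce); last exact: perm_inj.
  have -> : x \in tperm x y @: e by apply/imsetP; exists y; rewrite ?tpermR.
  rewrite -imset_comp andbT eqxx /=.
  rewrite (_ : _ @: e = phi @: e) //; apply: eq_in_imset => z ze /=.
  rewrite /upd; case: tpermP => [ezx|->|]; rewrite ?eqxx //.
    by move: ze; rewrite ezx (negbTE nxe).
  by move=> /eqP/negbTE ->.
have split (G : {set {set V}}) : #|G| = (#|[set e in G | x \notin e]| + deg G x)%N.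
  rewrite addnC -(cardsID [set e : {set V} | x \in e] G) /deg; congr (_ + _)%N.
    by apply: eq_card => e; rewrite !inE.
  by apply: eq_card => e; rewrite !inE andbC.
have le1 := subset_leq_card sub1; have le2 := subset_leq_card sub2.
rewrite card_imset in le2; last exact/imset_inj/perm_inj.
by rewrite (split D) (split D') addnAC leq_add2r leq_add.
Qed.

(* Zykov symmetrization one vertex at a time.  The pair (edge number, sum of the
   ranks of the values of phi) grows lexicographically, ties between degrees
   being broken by the rank, so the process ends. *)
Lemma symmetrization_ind (P : (V -> V) -> Prop) :
  (forall phi, two_covering phi -> P phi) ->
  (forall phi x y,
     (#|pullback r E phi| <= #|pullback r E (upd phi x (phi y))|)%N ->
     P (upd phi x (phi y)) -> P phi) ->
  forall phi, P phi.
Proof.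
move=> Pend Pstep phi.
pose n := #|V|; pose rk (z : V) : nat := enum_rank z.
(* The rank sum is at most [n * n], so this weight makes the order on [mu] lexicographic. *)
pose mu (phi : V -> V) := (#|pullback r E phi| * (n * n).+1 + \sum_z rk (phi z))%N.
have sum_le f : (\sum_(z : V) rk (f z) <= n * n)%N.
  rewrite {1}/n -sum_nat_const leq_sum // => z _; exact/ltnW/ltn_ord.
pose B := (#|{set V}| * (n * n).+1 + n * n)%N.
have muB f : (mu f <= B)%N by rewrite leq_add // leq_mul2r max_card orbT.
have [k] := ubnP (B - mu phi); elim: k phi => // k IHk phi lek.
have [cov|] := boolP [forall x, forall y, (phi x != phi y) ==>
    [exists e in E, [&& e \subset phi @: setT, phi x \in e & phi y \in e]]].
  apply: Pend => x y nxy; apply/exists_inP.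
  by move/forallP: cov => /(_ x)/forallP/(_ y); rewrite nxy.
rewrite negb_forall => /existsP[x0]; rewrite negb_forall => /existsP[y0].
rewrite negb_imply => /andP[nxy0 nexy0].
pose d := deg (pullback r E phi).
have [x [y [nxy nexy lex]]] : exists x y, [/\ phi x != phi y,
   ~~ [exists e in E, [&& e \subset phi @: setT, phi x \in e & phi y \in e]] &
   (d x < d y)%N || (d x == d y) && (rk (phi x) < rk (phi y))%N].
  have sym : ~~ [exists e in E, [&& e \subset phi @: setT, phi y0 \in e & phi x0 \in e]].
    apply: contra nexy0 => /exists_inP[e eE /and3P[h1 h2 h3]].
    by apply/exists_inP; exists e => //; rewrite h1 h2 h3.
  have nrk : rk (phi x0) != rk (phi y0).
    by apply: contra nxy0 => /eqP/ord_inj/enum_rank_inj ->.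
  have [ltd|gtd|eqd] := ltngtP (d x0) (d y0).
  - by exists x0, y0; rewrite ltd.
  - by exists y0, x0; rewrite gtd eq_sym.
  case: (ltngtP (rk (phi x0)) (rk (phi y0))) => [ltr|gtr|eqr].
  - by exists x0, y0; rewrite ltr eqd eqxx orbT.
  - by exists y0, x0; rewrite gtr eqd eqxx orbT eq_sym.
  - by rewrite eqr eqxx in nrk.
have := symmetrize_ge nxy nexy; rewrite -/(d x) -/(d y) => le_d.
have le_e : (#|pullback r E phi| <= #|pullback r E (upd phi x (phi y))|)%N.
  by case/orP: lex => [|/andP[/eqP]]; move: le_d; lia.
apply: (Pstep phi x y) => //; apply: IHk.
suff : (mu phi < mu (upd phi x (phi y)))%N by have := muB (upd phi x (phi y)); lia.
rewrite /mu; case/orP: lex => [ltd|/andP[_ ltr]].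
  have := sum_le phi; set s := \sum_z _; set s' := \sum_z _.
  have : (#|pullback r E phi| < #|pullback r E (upd phi x (phi y))|)%N by lia.
  by nia.
rewrite -addnS leq_add ?leq_mul2r ?le_e ?orbT //.
rewrite (bigD1 x) //= [ltnRHS](bigD1 x) //= {1}/upd eqxx.
rewrite (_ : (\sum_(i | i != x) rk (upd phi x (phi y) i) = \sum_(i | i != x) rk (phi i))%N).
  by rewrite ltn_add2r.
by apply: eq_bigr => i /negbTE nix; rewrite /upd nix.
Qed.

End Symmetrization.

(** * Counting edges *)

Local Open Scope ring_scope.

Lemma sum_card_fibers (T K : finType) (U : {set T}) (chi : T -> K) :
  (\sum_k #|[set x in U | chi x == k]| = #|U|)%N.
Proof.
rewrite -[RHS]sum1_card (partition_big chi predT) //=; apply: eq_bigr => k _.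
by rewrite -sum1_card; apply: eq_bigl => x; rewrite inE.
Qed.

(** Sort the edges by their color set [J]: at most the product of the class sizes over [J] share
    it. *)
Lemma card_le_elem_sym (R : realFieldType) (T K : finType) (U : {set T}) (chi : T -> K)
    (A : {set K}) m (D : {set {set T}}) :
  (forall e, e \in D -> [/\ e \subset U, #|e| = m, {in e &, injective chi} & chi @: e \subset A]) ->
  #|D|%:R <= elem_sym (fun k => #|[set x in U | chi x == k]|%:R : R) A m.
Proof.
move=> hD; rewrite -sum1_card.
rewrite (partition_big (fun e : {set T} => chi @: e) (fun J : {set K} => (J \subset A) && (#|J| == m))) /=; last first.
  by move=> e /hD[_ <- /card_in_imset-> ->]; rewrite eqxx.
rewrite natr_sum; apply: ler_sum => J /andP[_ /eqP cJ].
rewrite -natr_prod ler_nat -card_transversals sum1_card subset_leq_card //.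
apply/subsetP => e; rewrite !inE => /andP[/hD[-> -> _ _] ->].
by rewrite cJ eqxx.
Qed.

Lemma bin_le_exp n k : ('C(n, k) <= n ^ k)%N.
Proof.
rewrite -(leq_pmul2r (fact_gt0 k)) bin_ffact.
apply: leq_trans (leq_pmulr _ (fact_gt0 k)).
by elim: k => // k IHk; rewrite ffactnSr expnSr leq_mul // leq_subr.
Qed.

Lemma card_sets_through2 (T : finType) (s w : T) p : s != w ->
  (#|[set e : {set T} | [&& #|e| == p.+2, s \in e & w \in e]]| <= #|T| ^ p)%N.
Proof.
move=> nsw; apply: leq_trans (bin_le_exp _ _); rewrite -card_draws.
have inj : {in [set e : {set T} | [&& #|e| == p.+2, s \in e & w \in e]] &,
    injective (fun e => e :\ s :\ w)}.
  move=> e f; rewrite !inE => /and3P[_ se we] /and3P[_ sf wf] eef.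
  rewrite -(setD1K se) -(setD1K (a := w) (A := e :\ s)) ?inE ?we ?andbT 1?eq_sym // eef.
  by rewrite setD1K ?setD1K // !inE wf eq_sym nsw.
rewrite -(card_in_imset inj) subset_leq_card //; apply/subsetP => _ /imsetP[e + ->].
rewrite !inE => /and3P[/eqP ce se we].
have := cardsD1 s e; have := cardsD1 w (e :\ s).
rewrite ce se !inE we eq_sym nsw /= => -> []; lia.
Qed.

Lemma card_bigcup_le (I T : finType) (A : pred I) (F : I -> {set T}) :
  (#|\bigcup_(i in A) F i| <= \sum_(i in A) #|F i|)%N.
Proof.
elim/big_rec2: _ => [|i n S _ le]; first by rewrite cards0.
by rewrite (leq_trans (leq_card_setU _ _)) // leq_add2l.
Qed.

(** Discarding a set of zeta n vertices costs any other vertex at most zeta n^(p+1) of its edges,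
    which is small against a degree of order n^(p+1). *)
Lemma card_edges_meeting (T : finType) (E : {set {set T}}) (s : T) (A : {set T}) p :
  (forall e, e \in E -> #|e| = p.+2) -> s \notin A ->
  (#|[set e in E | (s \in e) && ~~ [disjoint e & A]]| <= #|A| * #|T| ^ p)%N.
Proof.
move=> hE sA; rewrite -sum_nat_const.
apply: leq_trans (_ : (\sum_(w in A) #|[set e : {set T} | [&& #|e| == p.+2, s \in e & w \in e]]| <= _)%N); last first.
  apply: leq_sum => w wA; apply: card_sets_through2.
  by apply: contraNneq sA => ->.
apply: leq_trans (card_bigcup_le _ _); apply/subset_leq_card/subsetP => e.
rewrite inE => /and3P[eE se /pred0Pn[w /andP[/= we wA]]].
by apply/bigcupP; exists w => //; rewrite inE se we hE // eqxx.
Qed.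

(* The Lagrangian of the complete r-graph on l vertices. *)
Definition lam (R : realFieldType) (l r : nat) : R := 'C(l, r)%:R / l%:R ^+ r.

Lemma lam_le1 (R : realFieldType) l r : (0 < l)%N -> lam R l r <= 1.
Proof.
move=> l0; rewrite /lam ler_pdivrMr ?exprn_gt0 ?ltr0n // mul1r -natrX ler_nat.
exact: bin_le_exp.
Qed.

Lemma lam_ge0 (R : realFieldType) l r : 0 <= lam R l r.
Proof. by rewrite divr_ge0 ?exprn_ge0 ?ler0n. Qed.

Lemma proper_card_le (R : realFieldType) (V : finType) (E : {set {set V}}) l r
    (chi : V -> 'I_l) :
  (0 < l)%N -> (forall e, e \in E -> #|e| = r) -> proper E set0 chi ->
  #|E|%:R <= lam R l r * #|V|%:R ^+ r.
Proof.
move=> l0 hE chiP; rewrite mulrAC ler_pdivlMr ?exprn_gt0 ?ltr0n // mulrC.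
apply: le_trans (_ : l%:R ^+ r * elem_sym (fun k => #|[set x in [set: V] | chi x == k]|%:R : R)
  [set: 'I_l] r <= _).
  apply: ler_wpM2l; first by rewrite exprn_ge0 ?ler0n.
  apply: card_le_elem_sym => e eE; split; rewrite ?subsetT ?hE //.
  by apply: chiP => //; rewrite disjoint_sym disjoints_subset sub0set.
have /(_ r) := maclaurin (x := fun k => #|[set x in [set: V] | chi x == k]|%:R : R) [set: 'I_l] (fun=> ler0n _ _).
rewrite cardsT card_ord -natr_sum => /le_trans; apply.
rewrite (eq_bigl predT); last by move=> k; rewrite inE.
by rewrite sum_card_fibers cardsT.
Qed.

Lemma sum_deg (V : finType) (E : {set {set V}}) r :
  (forall e, e \in E -> #|e| = r) -> (\sum_x deg E x = r * #|E|)%N.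
Proof.
move=> hE; rewrite mulnC -sum_nat_const.
transitivity (\sum_x \sum_(e in E | x \in e) 1)%N.
  by apply: eq_bigr => x _; rewrite sum1dep_card; apply: eq_card => e; rewrite !inE.
rewrite (exchange_big_dep (fun e => e \in E)) /=; last by move=> x e _ /andP[].
apply: eq_bigr => e eE; rewrite -(hE e eE) -sum1_card; apply: eq_bigl => x.
by rewrite eE.
Qed.

(** * The edge bound from the Lagrangian gap *)

Section UpperBound.

Variables (R : realFieldType) (r l : nat) (F : ugraph r) (s0 : R).
Hypotheses (l_gt0 : (0 < l)%N) (r_gt1 : (1 < r)%N) (s0_lt : s0 < lam R l r).
Hypothesis lagrangian_le : forall G : ugraph r, family_free (eq F) G ->
  ~ is_colorable (complete_ugraph r l) G ->
  forall x : vertex G -> R, (forall i, 0 <= x i) -> \sum_i x i = 1 ->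
  \sum_(e in edges G) \prod_(i in e) x i <= s0.

(** Let [G] be the graph induced on the image of [phi]. Its pairs are all covered, so a copy of F in
    it would be a core, and a coloring of it would be injective, which more than [l] vertices
    exclude. *)
Lemma two_covering_dichotomy (V : finType) (E : {set {set V}}) (phi : V -> V) :
  (forall e, e \in E -> #|e| = r) -> core_free F E -> two_covering E phi ->
  (exists chi : V -> 'I_l, proper (pullback r E phi) set0 chi) \/
  #|pullback r E phi|%:R <= s0 * #|V|%:R ^+ r.
Proof.
move=> hE cfE cov; pose K : finType := {x : V | x \in phi @: setT}.
have phiK z : phi z \in phi @: setT by rewrite imset_f.
pose f z : K := Sub (phi z) (phiK z).
have vf z : val (f z) = phi z by [].
have [leK|ltK] := leqP #|K| l.
  left; exists (fun z => widen_ord leK (enum_rank (f z))) => e eP _ x y xe ye /(congr1 val) /= /ord_inj/enum_rank_inj/(congr1 val).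
  by apply: (pullback_inj hE eP).
right; pose G : ugraph r := ugraph_of r (fun e : {set K} => val @: e \in E).
have edgesG (e : {set K}) : (e \in edges G) = (val @: e \in E).
  rewrite inE; case eE: (val @: e \in E); rewrite ?andbF // andbT.
  by rewrite -(hE _ eE) card_imset ?eqxx //; exact: val_inj.
have covG (x y : K) : x != y -> exists2 e, e \in edges G & (x \in e) && (y \in e).
  have /imsetP[zx _ ex] := valP x; have /imsetP[zy _ ey] := valP y => nxy.
  have [|e eE /and3P[sub xe ye]] := cov zx zy.
    by rewrite -ex -ey; apply: contra nxy => /eqP/val_inj ->.
  have ve : val @: [set k : K | val k \in e] = e.
    apply/setP => z; apply/imsetP/idP => [[k /[!inE] ke ->] //|ze].
    by exists (Sub z (subsetP sub z ze) : K); rewrite ?inE.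
  exists [set k : K | val k \in e]; first by rewrite edgesG ve.
  by rewrite !inE ex ey xe ye.
have Gfree : family_free (eq F) G.
  move=> _ <- [g gI gE]; apply: (cfE (val \o g)).
  - exact: inj_comp val_inj gI.
  - by move=> e /gE; rewrite edgesG -imset_comp.
  - move=> x y nxy; have [|e eG /andP[xe ye]] := covG (g x) (g y).
      by apply: contra nxy => /eqP/gI ->.
    by apply/coveredP; exists (val @: e); rewrite -?edgesG //= !imset_f.
have Gncol : ~ is_colorable (complete_ugraph r l) G.
  move=> [B [psi psiP] [h hI hB]].
  suff /leq_card : injective (psi \o h) by rewrite card_ord leqNgt ltK.
  move=> x y /= exy; apply/eqP; apply/negP => /negP nxy; have [e eG /andP[xe ye]] := covG x y nxy.
  have ce : #|h @: e| = r by rewrite card_imset //; apply/eqP/(forall_inP (edges_uniform G)).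
  have := hB e eG; rewrite psiP // inE andbT => /eqP cpsi.
  have inj : {in h @: e &, injective psi} by apply/imset_injP; rewrite cpsi ce.
  case/eqP: nxy; apply: hI; apply: inj => //; exact: imset_f.
have n0 : 0 < #|V|%:R :> R.
  rewrite ltr0n; apply: leq_trans (_ : #|K| <= _)%N; first by apply: leq_ltn_trans ltK.
  by apply: leq_trans (max_card (mem (phi @: setT))); rewrite card_sig.
(* Weights proportional to the fibres of [f]: scaled by n^r, the Lagrangian polynomial of [G] at [x]
   counts the edges of the blowup. *)
pose x k : R := #|[set z in [set: V] | f z == k]|%:R / #|V|%:R.
have x_ge0 k : 0 <= x k by rewrite divr_ge0 ?ler0n.
have x_sum1 : \sum_k x k = 1.
  by rewrite -mulr_suml -natr_sum sum_card_fibers cardsT divff ?gt_eqF.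
have := lagrangian_le Gfree Gncol x_ge0 x_sum1.
rewrite -(ler_pM2r (exprn_gt0 r n0)); apply: le_trans.
rewrite -sum1_card (partition_big (fun e : {set V} => f @: e) (fun J => J \in edges G)) /=; last first.
  by move=> e; rewrite inE edgesG -imset_comp => /andP[].
rewrite natr_sum mulr_suml; apply: ler_sum => J JG.
have cJ : #|J| = r by apply/eqP/(forall_inP (edges_uniform G)).
rewrite -cJ -prodr_const -big_split /=.
rewrite (eq_bigr (fun k => #|[set z in [set: V] | f z == k]|%:R)); last first.
  by move=> k _; rewrite divfK ?gt_eqF.
rewrite -natr_prod ler_nat -card_transversals sum1_card subset_leq_card //.
apply/subsetP => e /andP[/pullback_uniform ce eJ].
by rewrite inE subsetT ce cJ eqxx.
Qed.

Lemma core_free_card_le (V : finType) (E : {set {set V}}) :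
  (forall e, e \in E -> #|e| = r) -> core_free F E ->
  #|E|%:R <= lam R l r * #|V|%:R ^+ r.
Proof.
move=> hE cfE; rewrite -{1}(pullback_id hE).
apply: (symmetrization_ind (E := E) (r := r)
  (P := fun phi => #|pullback r E phi|%:R <= lam R l r * #|V|%:R ^+ r)).
  move=> phi cov; case: (two_covering_dichotomy hE cfE cov) => [[chi chiP]|le].
    by apply: proper_card_le chiP => //; exact: pullback_uniform.
  by apply: le_trans le _; rewrite ler_wpM2r ?exprn_ge0 ?ler0n // ltW.
move=> phi x y le; apply: le_trans; by rewrite ler_nat.
Qed.

(** The subgraph induced on [A] is the pullback along the inclusion, so it is core-free as well. *)
Lemma core_free_card_sub_le (V : finType) (E : {set {set V}}) (A : {set V}) :
  (forall e, e \in E -> #|e| = r) -> core_free F E ->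
  #|[set e in E | e \subset A]|%:R <= lam R l r * #|A|%:R ^+ r.
Proof.
move=> hE cfE; pose K : finType := {x : V | x \in A}.
have cfK := core_free_pullback (f := val : K -> V) hE cfE.
have := core_free_card_le (@pullback_uniform _ _ _ _ _) cfK.
rewrite card_sig; apply: le_trans; rewrite ler_nat.
rewrite -(card_imset _ (imset_inj val_inj)) subset_leq_card //.
apply/subsetP => e; rewrite inE => /andP[eE sA].
have ve : val @: [set k : K | val k \in e] = e.
  apply/setP => z; apply/imsetP/idP => [[k /[!inE] ke ->] //|ze].
  by exists (Sub z (subsetP sA z ze) : K); rewrite ?inE.
apply/imsetP; exists [set k : K | val k \in e]; rewrite ?ve // inE ve eE andbT.
by rewrite -(hE _ eE) -{2}ve card_imset //; exact: val_inj.
Qed.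

End UpperBound.

(** * Extending a coloring to one more vertex *)

Lemma exprB_superadd (R : realFieldType) (a h : R) k :
  0 <= h <= a -> (a - h) ^+ k.+1 + h ^+ k.+1 <= a ^+ k.+1.
Proof.
move=> /andP[h0 ha]; elim: k => [|k IHk]; first by rewrite !expr1; lra.
have a0 := le_trans h0 ha.
apply: le_trans (_ : a * ((a - h) ^+ k.+1 + h ^+ k.+1) <= _); last first.
  by rewrite [leRHS]exprS ler_wpM2l.
have ah0 : 0 <= a - h by lra.
rewrite mulrDr ![_ ^+ k.+2]exprS lerD // ler_wpM2r ?exprn_ge0 //; lra.
Qed.

Lemma exprD_le (R : realFieldType) (a h : R) k :
  0 <= a -> 0 <= h -> a + h <= 1 -> (a + h) ^+ k <= a ^+ k + k%:R * h.
Proof.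
move=> a0 h0 ah; elim: k => [|k IHk]; first by rewrite !expr0 mul0r addr0.
have ak : (a + h) ^+ k <= 1 by rewrite exprn_ile1 //; lra.
have a1 : a <= 1 by lra.
have := ler_wpM2r a0 IHk; have := ler_wpM2r h0 ak.
have : k%:R * h * a <= k%:R * h by rewrite ler_piMr // mulr_ge0 ?ler0n.
rewrite [(a + h) ^+ k.+1]exprSr [a ^+ k.+1]exprSr -(addn1 k) natrD; lra.
Qed.

Section PartialTransversals.

Variables (V : finType) (l : nat) (chi : V -> 'I_l).

Lemma card_ffun_through (e : {set V}) : {in e &, injective chi} ->
  (#|[set f : {ffun 'I_l -> V} | [forall x in e, f (chi x) == x]]| <= #|V| ^ (l - #|e|))%N.
Proof.
move=> inj; pose G k := [pred y : V | (k \in chi @: e) ==> ((y \in e) && (chi y == k))].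
apply: leq_trans (_ : #|family G| <= _)%N.
  apply/subset_leq_card/subsetP => f; rewrite inE => /forall_inP fe.
  apply/familyP => k; rewrite inE; apply/implyP => /imsetP[x xe ->].
  by rewrite (eqP (fe x xe)) xe /=.
rewrite card_family foldrE big_image /= (bigID (fun k => k \in chi @: e)) /=.
rewrite -[leqRHS]mul1n leq_mul //.
  apply: (big_ind (fun n => (n <= 1)%N)) => // [a b a1 b1|k ke].
    exact: leq_mul a1 b1.
  apply/card_le1_eqP => x y /implyP/(_ ke)/andP[xe /eqP xk] /implyP/(_ ke)/andP[ye /eqP yk].
  by apply: inj => //; rewrite xk yk.
apply: leq_trans (_ : \prod_(k in ~: (chi @: e)) #|V| <= _)%N.
  rewrite [leqRHS](eq_bigl (fun k => k \notin chi @: e)) => [|k]; last by rewrite inE.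
  by apply: leq_prod => k _; apply: max_card.
by rewrite prod_nat_const cardsCs setCK card_ord card_in_imset.
Qed.

End PartialTransversals.

Section Extension.

Variables (R : realFieldType) (p m : nat).
Hypothesis pm : (p < m)%N.
Variables (C L N : R).
(** Naming these three quantities keeps the casts out of the inequalities below. [C / L ^+ p.+1] is
    the degree density of a balanced blowup of the complete graph. *)
Hypotheses (C_def : 'C(m, p.+1)%:R = C) (L_def : m.+1%:R = L).

Variables (V : finType) (E : {set {set V}}) (W : {set V}) (v : V) (chi : V -> 'I_m.+1).
Hypothesis N_def : #|V|%:R = N.
Let U := ~: (v |: W).
Let part k := [set x in U | chi x == k].

Hypothesis E_uniform : forall e, e \in E -> #|e| = p.+2.
Hypothesis chi_proper : proper E (v |: W) chi.

Variables (beta eta zeta : R).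
Hypotheses (beta_gt0 : 0 < beta) (eta_ge0 : 0 <= eta) (zeta_ge0 : 0 <= zeta).
Hypothesis small_W : #|v |: W|%:R <= zeta * N.
Hypothesis deg_ge : forall x, x \notin W -> (C / L ^+ p.+1 - zeta) * N ^+ p.+1 <= (deg E x)%:R.
Hypothesis zeta_small : 2 * zeta * m%:R ^+ p.+1 < eta ^+ p.+1.
Hypothesis m_eta : m%:R * eta + zeta + beta <= L^-1.
(** Bounds the share of transversal sets through a vertex that are not edges: [2 * zeta] for the
    degree deficit, the other term for parts larger than n/L. *)
Let mu : R := C * p.+1%:R * eta + 2 * zeta.
Hypothesis mu_small : p.+3%:R * mu < beta ^+ m.+1.

Let N_gt0 : 0 < N. Proof. by rewrite -N_def ltr0n; apply/card_gt0P; exists v. Qed.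
Let L_gt0 : 0 < L. Proof. by rewrite -L_def ltr0Sn. Qed.
Let N_ge0 : 0 <= N. Proof. exact: ltW. Qed.
Let C_ge1 : 1 <= C. Proof. by rewrite -C_def ler1n bin_gt0. Qed.
Let m_ge1 : 1 <= m%:R :> R. Proof. by rewrite ler1n; case: (m) pm. Qed.
Let L_eq : L = m%:R + 1. Proof. by rewrite -L_def -addn1 natrD. Qed.
Let mL : m%:R / L = 1 - L^-1 :> R.
Proof. by rewrite L_eq; field; rewrite -L_eq; apply: lt0r_neq0. Qed.

Lemma deg_inside x : x \in U ->
  (C / L ^+ p.+1 - 2 * zeta) * N ^+ p.+1 <= #|[set e in E | (x \in e) && (e \subset U)]|%:R.
Proof.
rewrite !inE negb_or => /andP[xv xW].
have := @card_edges_meeting _ E x (v |: W) p E_uniform.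
rewrite !inE negb_or xv xW => /(_ isT); set D1 := [set e in E | _] => le1.
set D2 := [set e in E | _].
have : (deg E x <= #|D1| + #|D2|)%N.
  apply: leq_trans (leq_card_setU _ _); apply/subset_leq_card/subsetP => e.
  rewrite !inE => /andP[-> ->]; rewrite /= disjoints_subset.
  by case: (e \subset U).
rewrite -(ler_nat R) natrD => le2; have := deg_ge xW.
have : #|D1|%:R <= zeta * N ^+ p.+1.
  apply: le_trans (_ : (#|v |: W| * #|V| ^ p)%:R <= _); first by rewrite ler_nat.
  by rewrite natrM natrX N_def exprS mulrA ler_wpM2r ?exprn_ge0 ?ler0n.
lra.
Qed.

Let transv x := [set e : {set V} | [&& e \subset U, #|e| == p.+2, x \in e & #|chi @: e| == p.+2]].

Let card_transv x : #|transv x|%:R <= elem_sym (fun k => #|part k|%:R : R) (~: [set chi x]) p.+1.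
Proof.
rewrite -(@card_in_imset _ _ (fun e : {set V} => e :\ x) (transv x)); last first.
  move=> e f; rewrite !inE => /and4P[_ _ xe _] /and4P[_ _ xf _] eef.
  by rewrite -(setD1K xe) eef setD1K.
apply: card_le_elem_sym => _ /imsetP[e + ->]; rewrite inE => /and4P[eU /eqP ce xe ie].
have inj : {in e &, injective chi} by apply/imset_injP; rewrite ce.
split.
- exact: subset_trans (subD1set _ _) eU.
- by have := cardsD1 x e; rewrite xe ce => -[].
- by move=> y z /setD1P[_ ye] /setD1P[_ ze]; apply: inj.
- apply/subsetP => _ /imsetP[y /setD1P[yx ye] ->]; rewrite !inE.
  by apply: contra yx => /eqP/inj->.
Qed.

Let inside_transv x : [set e in E | (x \in e) && (e \subset U)] \subset transv x.
Proof.
apply/subsetP => e; rewrite !inE => /and3P[eE xe eU].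
rewrite eU xe E_uniform //= eqxx card_in_imset ?E_uniform ?eqxx //.
by apply: (chi_proper eE); rewrite disjoints_subset.
Qed.

(** The edges inside [U] at a vertex of an oversized part complete it from the other parts, which
    together have fewer than (m/L - eta) n vertices. Maclaurin bounds its degree, and
    superadditivity of powers turns the deficit [eta] into [eta ^+ p.+1], more than [zeta_small]
    permits. *)
Lemma card_part_le k : #|part k|%:R <= (L^-1 + eta) * N.
Proof.
rewrite leNgt; apply/negP => lt_k.
have /card_gt0P[x] : (0 < #|part k|)%N.
  rewrite -(ltr0n R) (le_lt_trans _ lt_k) // mulr_ge0 ?ler0n //.
  by rewrite addr_ge0 // invr_ge0 ltW.
rewrite inE => /andP[xU /eqP xk].
have le1 : (C / L ^+ p.+1 - 2 * zeta) * N ^+ p.+1 <=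
    elem_sym (fun k => #|part k|%:R : R) (~: [set chi x]) p.+1.
  apply: le_trans (deg_inside xU) _; apply: le_trans (card_transv x).
  by rewrite ler_nat subset_leq_card.
have := @maclaurin _ _ (fun k => #|part k|%:R : R) (~: [set chi x]) (fun=> ler0n _ _) p.+1.
rewrite cardsC1 card_ord /=; set y := \sum_(i in _) _; rewrite C_def => le2.
have y0 : 0 <= y by apply: sumr_ge0 => *; apply: ler0n.
have y_lt : y < (m%:R / L - eta) * N.
  have : y + #|part k|%:R <= N.
    have : (\sum_i #|part i| <= #|V|)%N by rewrite sum_card_fibers max_card.
    rewrite -(ler_nat R) N_def natr_sum (bigD1 k) //= addrC /y xk; congr (_ + _ <= _).
    by apply: eq_bigl => i; rewrite !inE.
  rewrite mL; lra.
have a0 : 0 <= m%:R / L - eta by rewrite -(pmulr_lge0 _ N_gt0) (le_trans y0) // ltW.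
have le3 : y ^+ p.+1 <= (m%:R / L - eta) ^+ p.+1 * N ^+ p.+1.
  by rewrite -exprMn lerXn2r ?nnegrE ?mulr_ge0 // ltW.
have le4 := @exprB_superadd _ (m%:R / L) eta p.
have {le4}le4 : (m%:R / L - eta) ^+ p.+1 + eta ^+ p.+1 <= m%:R ^+ p.+1 / L ^+ p.+1.
  by rewrite -expr_div_n; apply: le4; rewrite eta_ge0 -subr_ge0.
have Np : 0 < N ^+ p.+1 by rewrite exprn_gt0.
have mp : 0 <= m%:R ^+ p.+1 :> R by rewrite exprn_ge0 ?ler0n.
have le5 := le_trans (ler_wpM2l mp le1) le2.
have le6 := le_trans le5 (ler_wpM2l (le_trans ler01 C_ge1) le3).
have : m%:R ^+ p.+1 * (C / L ^+ p.+1 - 2 * zeta) <= C * (m%:R / L - eta) ^+ p.+1.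
  by rewrite -(ler_pM2r Np) -!mulrA.
have := ler_wpM2l (le_trans ler01 C_ge1) le4.
have : eta ^+ p.+1 <= C * eta ^+ p.+1 by rewrite ler_peMl ?exprn_ge0.
move: zeta_small; lra.
Qed.

Lemma L_eta_le1 : L^-1 + eta <= 1.
Proof.
have : L^-1 <= 1 - L^-1 by rewrite -mL ler_pdivlMr // mulVf ?gt_eqF.
have : eta <= m%:R * eta by rewrite ler_peMl.
move: m_eta beta_gt0 zeta_ge0; lra.
Qed.

Lemma card_part_ge k : beta * N <= #|part k|%:R.
Proof.
have : N <= zeta * N + \sum_k #|part k|%:R.
  by rewrite -natr_sum sum_card_fibers -{1}N_def -(cardsC (v |: W)) natrD lerD2r.
rewrite (bigD1 k) //=.
have : \sum_(i < m.+1 | i != k) #|part i|%:R <= m%:R * ((L^-1 + eta) * N).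
  apply: le_trans (ler_sum _ (fun i _ => card_part_le i)) _.
  rewrite sumr_const mulr_natl cardC1 card_ord //.
have : (m%:R * eta + zeta + beta) * N <= L^-1 * N by rewrite ler_pM2r.
have : m%:R * L^-1 * N = (1 - L^-1) * N by rewrite mL.
lra.
Qed.

Lemma elem_sym_part_le A :
  elem_sym (fun k => #|part k|%:R : R) A p.+1 <=
  'C(#|A|, p.+1)%:R * (L ^- p.+1 + p.+1%:R * eta) * N ^+ p.+1.
Proof.
have := @elem_sym_le_const R _ (fun k => #|part k|%:R : R) A (fun=> ler0n _ _) p.+1 _ (fun k _ => card_part_le k).
move/le_trans; apply.
rewrite -mulrA ler_wpM2l ?ler0n // exprMn ler_wpM2r ?exprn_ge0 ?ler0n //.
rewrite -exprVn exprD_le ?L_eta_le1 // invr_ge0; exact: ltW.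
Qed.

Let missing x := transv x :\: E.

Lemma card_missing x : x \in U -> #|missing x|%:R <= mu * N ^+ p.+1.
Proof.
move=> xU; have le1 := deg_inside xU.
have le2 := le_trans (card_transv x) (elem_sym_part_le _).
rewrite cardsC1 card_ord /= C_def in le2.
have : #|missing x|%:R + #|[set e in E | (x \in e) && (e \subset U)]|%:R <= #|transv x|%:R :> R.
  rewrite -natrD ler_nat -[leqRHS](cardsID E) addnC leq_add2r.
  apply/subset_leq_card/subsetP => e eD; rewrite inE (subsetP (inside_transv x)) //.
  by move: eD; rewrite inE => /andP[].
rewrite /mu; lra.
Qed.

(** One vertex per part, spanning a complete r-graph on m+1 vertices. *)
Definition good (w : 'I_m.+1 -> V) : Prop :=
  (forall k, w k \in U /\ chi (w k) = k) /\
  (forall I : {set 'I_m.+1}, #|I| = p.+2 -> w @: I \in E).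

(** A union bound. There are at least (beta n)^(m+1) candidate tuples. Failure of the tuple itself,
    or of its modification at one of the at most p+2 vertices of [S], excludes at most mu n^(m+1)
    tuples each; [mu_small] says that some tuple survives. *)
Lemma embedding (Nb : 'I_m.+1 -> {set V}) (S : {set V}) :
  (forall k, Nb k \subset part k) -> (forall k, beta * N <= #|Nb k|%:R) ->
  S \subset U -> (#|S| <= p.+2)%N ->
  exists w : 'I_m.+1 -> V, [/\ forall k, w k \in Nb k, good w &
    forall s, s \in S -> good (upd w (chi s) s)].
Proof.
move=> Nb_part Nb_big SU cS.
have Np : 0 <= N ^+ p.+1 by rewrite exprn_ge0 ?ler0n.
have mu0 : 0 <= mu by rewrite addr_ge0 ?mulr_ge0 ?ler0n // (le_trans ler01).
pose thr (e : {set V}) := [set f : {ffun 'I_m.+1 -> V} | [forall x in e, f (chi x) == x]].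
pose bad0 := \bigcup_(x in U) \bigcup_(e in missing x) thr e.
(* Only [e :\ s] has to occur in the tuple. This leaves one more free entry than in [bad0], offset
   by the fact that only the missing sets through the single vertex [s] count. *)
pose bad s := \bigcup_(e in missing s) thr (e :\ s).
have missP x e : e \in missing x -> [/\ e \subset U, #|e| = p.+2, x \in e & {in e &, injective chi}].
  rewrite !inE => /andP[_ /and4P[-> /eqP ce -> cce]]; split=> //.
  by apply/imset_injP; rewrite ce.
have cbad0 : #|bad0|%:R <= mu * N ^+ m.+1.
  have -> : N ^+ m.+1 = N * N ^+ p.+1 * N ^+ (m.+1 - p.+2).
    by rewrite -exprS -exprD subnKC.
  apply: le_trans (_ : (\sum_(x in U) #|missing x| * #|V| ^ (m.+1 - p.+2))%:R <= _).
    rewrite ler_nat; apply: leq_trans (card_bigcup_le _ _) _; apply: leq_sum => x _.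
    apply: leq_trans (card_bigcup_le _ _) _; rewrite -sum_nat_const.
    apply: leq_sum => e /missP[_ ce _ inj]; have := card_ffun_through inj.
    by rewrite ce.
  rewrite -big_distrl /= natrM natrX N_def mulrA ler_wpM2r ?exprn_ge0 ?ler0n //.
  rewrite natr_sum; apply: le_trans (_ : \sum_(x in U) mu * N ^+ p.+1 <= _).
    by apply: ler_sum => x /card_missing.
  rewrite sumr_const -mulr_natl mulrCA ler_wpM2l // ler_wpM2r //.
  by rewrite -N_def ler_nat max_card.
have cbad s : s \in S -> #|bad s|%:R <= mu * N ^+ m.+1.
  move=> /(subsetP SU) sU.
  have -> : N ^+ m.+1 = N ^+ p.+1 * N ^+ (m.+1 - p.+1).
    by rewrite -exprD subnKC // ltnW.
  apply: le_trans (_ : (#|missing s| * #|V| ^ (m.+1 - p.+1))%:R <= _).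
    rewrite ler_nat; apply: leq_trans (card_bigcup_le _ _) _; rewrite -sum_nat_const.
    apply: leq_sum => e /missP[_ ce se inj].
    have /card_ffun_through : {in e :\ s &, injective chi}.
      by move=> y z /setD1P[_ ye] /setD1P[_ ze]; apply: inj.
    by have := cardsD1 s e; rewrite se ce add1n => -[<-].
  by rewrite natrM natrX N_def mulrA ler_wpM2r ?exprn_ge0 ?ler0n // card_missing.
pose Bad := bad0 :|: \bigcup_(s in S) bad s.
have cBad : #|Bad|%:R <= p.+3%:R * mu * N ^+ m.+1.
  apply: le_trans (_ : #|bad0|%:R + \sum_(s in S) #|bad s|%:R <= _).
    rewrite -natr_sum -natrD ler_nat; apply: leq_trans (leq_card_setU _ _) _.
    by rewrite leq_add2l card_bigcup_le.
  have : \sum_(s in S) #|bad s|%:R <= p.+2%:R * (mu * N ^+ m.+1).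
    apply: le_trans (ler_sum _ cbad) _; rewrite sumr_const -[leLHS]mulr_natl.
    by rewrite ler_wpM2r ?ler_nat // mulr_ge0 // exprn_ge0 ?ler0n.
  by move: cbad0; rewrite -[p.+3]addn1 natrD; lra.
have : (#|Bad| < #|family (fun k => mem (Nb k))|)%N.
  rewrite -(ltr_nat R) card_family foldrE big_image /= natr_prod.
  apply: le_lt_trans cBad _.
  apply: lt_le_trans (_ : beta ^+ m.+1 * N ^+ m.+1 <= _).
    by rewrite ltr_pM2r ?exprn_gt0.
  have -> : beta ^+ m.+1 * N ^+ m.+1 = \prod_(k < m.+1) (beta * N).
    by rewrite prodr_const card_ord exprMn.
  by apply: ler_prod => k _; rewrite Nb_big mulr_ge0 // ltW.
move=> ltB; have /subsetPn[f /familyP fNb fBad] : ~~ (family (fun k => mem (Nb k)) \subset Bad).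
  by apply: contraL ltB => /subset_leq_card; rewrite leqNgt.
move: fBad; rewrite inE negb_or => /andP[f0 fS].
have fU k : f k \in U /\ chi (f k) = k.
  by have := subsetP (Nb_part k) _ (fNb k); rewrite inE => /andP[? /eqP].
have updU s k : s \in U -> upd f (chi s) s k \in U /\ chi (upd f (chi s) s k) = k.
  by move=> sU; rewrite /upd; case: eqP => [->|].
have missI (w : 'I_m.+1 -> V) (I : {set 'I_m.+1}) i : (forall k, w k \in U /\ chi (w k) = k) ->
    #|I| = p.+2 -> i \in I -> w @: I \notin E -> w @: I \in missing (w i).
  move=> wU cI iI nE; have wI : injective w by move=> j k /(congr1 chi); rewrite !(proj2 (wU _)).
  have c1 : #|w @: I| = p.+2 by rewrite card_imset.
  have c2 : chi @: (w @: I) = I.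
    by rewrite -imset_comp -[RHS]imset_id; apply: eq_imset => k /=; case: (wU k).
  rewrite inE nE inE c1 c2 cI eqxx imset_f // !andbT /=.
  by apply/subsetP => _ /imsetP[k _ ->]; case: (wU k).
have fgood : good f.
  split=> // I cI; apply: contraNT f0 => nE.
  have /card_gt0P[i iI] : (0 < #|I|)%N by rewrite cI.
  apply/bigcupP; exists (f i); first by case: (fU i).
  apply/bigcupP; exists (f @: I); first exact: missI.
  by rewrite inE; apply/forall_inP => _ /imsetP[k _ ->]; case: (fU k) => _ ->.
exists f; split=> // s sS; have sU := subsetP SU s sS.
split=> [k|I cI]; first exact: updU.
have [sI|sI] := boolP (chi s \in I); last first.
  rewrite (_ : _ @: I = f @: I); first by case: fgood => _; apply.
  by apply: eq_in_imset => k kI; rewrite /upd; case: eqP kI sI => // -> ->.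
apply: contraNT fS => nE; apply/bigcupP; exists s => //.
have us : upd f (chi s) s (chi s) = s by rewrite /upd eqxx.
apply/bigcupP; exists (upd f (chi s) s @: I).
  by have := missI _ I (chi s) (fun k => updU s k sU) cI sI nE; rewrite us.
rewrite inE; apply/forall_inP => x /setD1P[xs /imsetP[k _ ek]]; move: xs; rewrite {x}ek.
by rewrite /upd; case: (k =P chi s) => [_|_ _]; rewrite ?eqxx //; case: (fU k) => _ ->.
Qed.

Lemma good_covered w k k' : good w -> k != k' -> covered E (w k) (w k').
Proof.
move=> [_ wE] nkk'; have [||I sI /andP[_ /eqP cI]] := @ex_subset_card _ [set k; k'] setT p.+2.
- exact: subsetT.
- by rewrite cards2 nkk' cardsT card_ord.
by apply/coveredP; exists (w @: I); rewrite ?wE // !imset_f // (subsetP sI) // !inE eqxx ?orbT.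
Qed.

Variables (F : ugraph p.+2) (a : vertex F) (T : {set vertex F}).
Hypotheses (card_F : #|vertex F| = m.+2) (aT : a \notin T) (T_gt0 : (0 < #|T|)%N)
  (T_le : (#|T| <= p.+1)%N).
Hypothesis edges_a : forall e, e \in edges F -> a \in e -> e = a |: T.
Hypothesis edges_na : forall e, e \in edges F -> a \notin e -> (#|e :&: T| <= 1)%N.
Hypothesis E_core_free : core_free F E.

Let edges_F_card (e : {set vertex F}) : e \in edges F -> #|e| = p.+2.
Proof. by move=> eF; apply/eqP/(forall_inP (edges_uniform F)). Qed.

Let card_a : (#|~: [set a]| <= #|'I_m.+1|)%N.
Proof. by rewrite cardsC1 card_F card_ord. Qed.

(* Otherwise u, u' and a good tuple through u would carry a core: an uncovered
   pair of F goes to u, u' and the remaining vertices into the other parts. *)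
Lemma covered_proper u u' : u \in U -> u' \in U -> u != u' -> covered E u u' ->
  chi u != chi u'.
Proof.
move=> uU u'U nuu' cuu'; apply/negP => /eqP exy; pose i := chi u.
have [||||w [_ wgood wS]] := @embedding part [set u; u'].
- by [].
- exact: card_part_ge.
- by rewrite subUset !sub1set uU.
- by rewrite cards2 nuu'.
have goodu : good (upd w i u) by apply: wS; rewrite !inE eqxx.
have goodu' : good (upd w i u') by rewrite /i exy; apply: wS; rewrite !inE eqxx orbT.
(* No edge contains both [a] and [b]: this is the uncovered pair that goes to [u'] and [u]. *)
have [b bT] : exists b, b \notin a |: T.
  have : (0 < #|~: (a |: T)|)%N.
    rewrite -(ltn_add2l #|a |: T|) addn0 cardsC card_F cardsU1 aT add1n !ltnS.
    exact: leq_trans T_le pm.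
  by case/card_gt0P => b; rewrite inE; exists b.
have ba : b != a by apply: contraNneq bT => ->; rewrite setU11.
have [||c cI cb] := @ex_inj_imset _ _ i (~: [set a]) [set b] [set i] _ _ card_a.
- by rewrite sub1set !inE.
- by rewrite !cards1.
have {}cb : c b = i by apply/set1P; rewrite -cb imset_f // set11.
have upd_i x : upd w i x i = x by rewrite /upd eqxx.
have upd_n x y j : j != i -> upd w i x j = upd w i y j.
  by rewrite /upd => /negbTE->.
have cA x : x != a -> x \in ~: [set a] by rewrite !inE.
have chi_upd y : chi (upd w i u y) = y by case: goodu => /(_ y)[].
(* An edge through [a] avoids [b] and lands in the tuple through [u']; every other edge lands in the
   tuple through [u]. *)
pose g x := if x == a then u' else upd w i u (c x).
have gna x : x != a -> g x = upd w i u (c x) by rewrite /g => /negbTE->.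
have ga : g a = u' by rewrite /g eqxx.
have u'n y : upd w i u y != u'.
  apply/eqP => e; have ey : y = i by rewrite -(chi_upd y) e /i exy.
  by move: e nuu'; rewrite ey upd_i => ->; rewrite eqxx.
apply: (E_core_free (g := g)).
- move=> x y; have [->|xa] := eqVneq x a; have [->|ya] := eqVneq y a => //.
  + by rewrite ga gna // => e; move: (u'n (c y)); rewrite -e eqxx.
  + by rewrite ga gna // => e; move: (u'n (c x)); rewrite e eqxx.
  + by rewrite !gna // => /(congr1 chi); rewrite !chi_upd; apply: cI; apply: cA.
- move=> e eF; have [ae|ae] := boolP (a \in e).
    have be : b \notin e by rewrite (edges_a eF ae).
    pose c1 x := if x == a then i else c x.
    have -> : g @: e = upd w i u' @: (c1 @: e).
      rewrite -imset_comp; apply: eq_in_imset => x xe /=; rewrite /g /c1.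
      case: (x =P a) => [_|/eqP xa]; first by rewrite upd_i.
      apply: upd_n; apply: contra be => /eqP; rewrite -cb => /cI <- //; exact: cA.
    case: goodu' => _; apply; rewrite card_in_imset ?edges_F_card //.
    have ib y : y \in e -> y != a -> i <> c y.
      move=> ye ya; rewrite -cb => /cI eby; move: be; rewrite eby ?ye //; exact: cA.
    move=> x y xe ye; rewrite /c1; case: (x =P a) => [->|/eqP xa]; case: (y =P a) => [->|/eqP ya] //.
    + by move/(ib y ye ya).
    + by move/esym/(ib x xe xa).
    + by apply: cI; apply: cA.
  have nxa x : x \in e -> x != a by apply: contraTneq => ->.
  have -> : g @: e = upd w i u @: (c @: e).
    by rewrite -imset_comp; apply: eq_in_imset => x xe /=; rewrite gna ?nxa.
  case: goodu => _; apply; rewrite card_in_imset ?edges_F_card // => x y xe ye.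
  by apply: cI; apply/cA/nxa.
- have cov_a y : y != a -> covered E u' (g y).
    move=> ya; rewrite gna //; have [->|ni] := eqVneq (c y) i.
      by rewrite upd_i coveredC.
    rewrite (upd_n u u') // -{1}(upd_i u'); apply: good_covered => //.
    by rewrite eq_sym.
  move=> x y; have [->|xa] := eqVneq x a; have [->|ya] := eqVneq y a => nxy.
  + by move: nxy; rewrite ?eqxx.
  + by rewrite ga cov_a.
  + by rewrite ga coveredC cov_a.
  + rewrite !gna //; apply: good_covered => //.
    by apply: contra nxy => /eqP/cI -> //; exact: cA.
Qed.

(** * The color of the remaining vertex *)

(** It may contain [v] itself, which is harmless: it is only intersected with parts, and these avoid
    [v]. *)
Definition link_vertices : {set V} :=
  [set x | [exists e in E, [&& [disjoint e & W], v \in e & x \in e]]].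

Let big_part k := beta * N <= #|link_vertices :&: part k|%:R.

Let edge_v e : e \in E -> [disjoint e & W] -> v \in e ->
  e :\ v \subset U /\ {in e :\ v &, injective chi}.
Proof.
move=> eE eW ve; have sU : e :\ v \subset U.
  apply/subsetP => x /setD1P[xv xe]; rewrite !inE negb_or xv /=.
  by apply: contraL xe => xW; rewrite (disjointFl eW).
split=> // x y xe ye exy; apply/eqP; apply: contraPT exy => nxy; apply/eqP.
apply: covered_proper; rewrite ?(subsetP sU) //.
by apply/coveredP; exists e; rewrite ?eE // (subsetP (subD1set _ _) _ xe) (subsetP (subD1set _ _) _ ye).
Qed.

(* Otherwise an edge {v} + S with u in S gives a core: send a to v, T into S,
   and the other vertices of F to neighbours of v in the remaining parts. *)
Lemma not_all_big u : u \in link_vertices -> u != v -> exists2 k, k != chi u & ~~ big_part k.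
Proof.
rewrite inE => /exists_inP[e eE /and3P[eW ve ue]] uv; apply/exists_inP.
apply: contraT; rewrite negb_exists_in => /forall_inP allbig.
have {}allbig k : k != chi u -> big_part k by move/allbig; rewrite negbK.
have [SU Sinj] := edge_v eE eW ve.
have cS : #|e :\ v| = p.+1 by have := cardsD1 v e; rewrite ve E_uniform // => -[].
have uS : u \in e :\ v by rewrite !inE uv.
have [||S' uS' /andP[S'S /eqP cS']] := @ex_subset_card _ [set u] (e :\ v) #|T|.
- by rewrite sub1set.
- by rewrite cards1 T_gt0 cS.
rewrite sub1set in uS'; have S'U := subset_trans S'S SU.
have S'inj : {in S' &, injective chi} by move=> x y /(subsetP S'S) xS /(subsetP S'S); apply: Sinj.
(* The part of [u] is not known to be big. Since [u] lies in [S'], its color goes to a vertex of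
   [T], so the entry of [w] in that color is a mere placeholder. *)
pose Nb k := if k == chi u then part k else link_vertices :&: part k.
have [|k||w [wN wgood wS]] := @embedding Nb S' _ _ S'U _.
- by move=> k; rewrite /Nb; case: ifP => // _; exact: subsetIr.
- by rewrite /Nb; case: eqP => [_|/eqP/allbig //]; exact: card_part_ge.
- by rewrite cS' ltnW.
have [||c cI cT] := @ex_inj_imset _ _ (chi u) (~: [set a]) T (chi @: S') _ _ card_a.
- by rewrite subsetC sub1set inE.
- by rewrite card_in_imset.
have cA x : x != a -> x \in ~: [set a] by rewrite !inE.
have Ta x : x \in T -> x != a by apply: contraTneq => ->.
pose s k := odflt v [pick x in S' | chi x == k].
have sP x : x \in T -> s (c x) \in S' /\ chi (s (c x)) = c x.
  move=> xT; have /imsetP[y yS' ey] : c x \in chi @: S' by rewrite -cT imset_f.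
  rewrite /s; case: pickP => [z /andP[zS' /eqP //]|/(_ y)].
  by rewrite /= yS' ey eqxx.
pose g x := if x == a then v else if x \in T then s (c x) else w (c x).
have ga : g a = v by rewrite /g eqxx.
have gT x : x \in T -> g x = s (c x) by move=> xT; rewrite /g (negbTE (Ta x xT)) xT.
have gn x : x != a -> x \notin T -> g x = w (c x) by rewrite /g => /negbTE-> /negbTE->.
have gU x : x != a -> g x \in U /\ chi (g x) = c x.
  move=> xa; have [xT|xT] := boolP (x \in T).
    by rewrite gT //; have [h ->] := sP x xT; rewrite (subsetP S'U).
  by rewrite gn //; case: wgood.
have gv x : x != a -> g x != v.
  by case/gU => h _; apply: contraTneq h => ->; rewrite !inE eqxx.
have gI : injective g.
  move=> x y; have [->|xa] := eqVneq x a; have [->|ya] := eqVneq y a => //.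
  + by rewrite ga => e1; move: (gv y ya); rewrite -e1 eqxx.
  + by rewrite ga => e1; move: (gv x xa); rewrite e1 eqxx.
  + by move/(congr1 chi); rewrite !(proj2 (gU _ _)) //; apply: cI; apply: cA.
have gTS : g @: T = S'.
  apply/eqP; rewrite eqEcard card_imset // cS' leqnn andbT.
  by apply/subsetP => _ /imsetP[x xT ->]; rewrite gT //; case: (sP x xT).
have upd_good x : x \in T -> good (upd w (c x) (s (c x))).
  by move=> xT; have [h <-] := sP x xT; rewrite {2}(proj2 (sP x xT)); apply: wS.
have S'e x : x \in S' -> x \in e by move/(subsetP S'S)/setD1P => [].
exfalso; apply: (E_core_free gI).
- move=> f fF; have [af|af] := boolP (a \in f).
    have ef := edges_a fF af; have cT1 : #|T| = p.+1.
      by have := edges_F_card fF; rewrite ef cardsU1 aT => -[].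
    have -> : g @: f = e.
      rewrite ef imsetU1 ga gTS -(setD1K ve); congr (_ |: _).
      by apply/eqP; rewrite eqEcard S'S cS cS' cT1 /=.
    exact: eE.
  have nxa x : x \in f -> x != a by apply: contraTneq => ->.
  have cf : #|c @: f| = p.+2.
    by rewrite card_in_imset ?edges_F_card // => x y xf yf; apply: cI; apply/cA/nxa.
  (* [embedding] allows one vertex of [S'] at a time to be swapped into the tuple; [edges_na]
     ensures that [f] needs no more. *)
  have [e0|[t]] := set_0Vmem (f :&: T).
    have -> : g @: f = w @: (c @: f).
      rewrite -imset_comp; apply: eq_in_imset => x xf /=; rewrite gn ?nxa //.
      by apply/negP => xT; move/setP/(_ x): e0; rewrite !inE xf xT.
    by case: wgood => _; apply.
  rewrite inE => /andP[tf tT].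
  have ft x : x \in f -> x \in T -> x = t.
    by move=> xf xT; apply: (card_le1_eqP (edges_na fF af)); rewrite inE ?xf ?tf.
  have -> : g @: f = upd w (c t) (s (c t)) @: (c @: f).
    rewrite -imset_comp; apply: eq_in_imset => x xf /=; rewrite /upd.
    case: eqP => [/cI ext|nct].
      by rewrite ext ?gT // ?cA ?nxa.
    by rewrite gn ?nxa //; apply/negP => /(ft x xf) ext; apply: nct; rewrite ext.
  by case: (upd_good t tT) => _; apply.
- have chiu x : x != a -> x \notin T -> c x != chi u.
    move=> xa xT; apply: contra xT => /eqP ecx.
    have : c x \in c @: T by rewrite cT ecx imset_f.
    by case/imsetP => y yT /cI -> //; apply: cA => //; exact: Ta.
  have cov_a y : y != a -> covered E v (g y).
    move=> ya; have [yT|yT] := boolP (y \in T).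
      by apply/coveredP; exists e => //; rewrite ve S'e // -gTS imset_f.
    have := wN (c y); rewrite /Nb (negbTE (chiu _ _ _)) // !inE -gn // => /andP[+ _].
    by case/exists_inP => f fE /and3P[_ vf gf]; apply/coveredP; exists f; rewrite ?vf.
  have cov_T x y : x \in T -> y != a -> y \notin T -> covered E (g x) (g y).
    move=> xT ya yT; have nc : c y != c x.
      by apply: contra yT => /eqP ec; rewrite (cI y x (cA y ya) (cA x (Ta x xT)) ec).
    have -> : g x = upd w (c x) (s (c x)) (c x) by rewrite /upd eqxx gT.
    have -> : g y = upd w (c x) (s (c x)) (c y) by rewrite /upd (negbTE nc) gn.
    by apply: good_covered; [exact: upd_good|rewrite eq_sym].
  move=> x y; have [->|xa] := eqVneq x a; have [->|ya] := eqVneq y a => nxy.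
  + by move: nxy; rewrite ?eqxx.
  + by rewrite ga cov_a.
  + by rewrite ga coveredC cov_a.
  have [xT|xT] := boolP (x \in T); have [yT|yT] := boolP (y \in T).
  + by apply/coveredP; exists e => //; rewrite !S'e // -gTS imset_f.
  + exact: cov_T.
  + by rewrite coveredC; exact: cov_T.
  + rewrite !gn //; apply: good_covered => //.
    by apply: contra nxy => /eqP/cI -> //; exact: cA.
Qed.

Hypothesis vW : v \notin W.
Hypothesis degree_gap : 2 * zeta + L * beta + C * p.+1%:R * eta < L ^- p.+1.

Let card_W : #|W|%:R <= zeta * N.
Proof. by apply: le_trans small_W; rewrite ler_nat subset_leq_card // subsetUr. Qed.

Let edges_meeting_le (A : {set V}) (t : R) : v \notin A -> #|A|%:R <= t * N ->
  #|[set e in E | (v \in e) && ~~ [disjoint e & A]]|%:R <= t * N ^+ p.+1.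
Proof.
move=> vA At; have := card_edges_meeting E_uniform vA; rewrite -(ler_nat R) => /le_trans; apply.
by rewrite natrM natrX N_def exprS mulrA ler_wpM2r ?exprn_ge0.
Qed.

Let deg_split (A : {set V}) :
  (deg E v <= #|[set e in E | (v \in e) && ~~ [disjoint e & A]]| +
              #|[set e in E | (v \in e) && [disjoint e & A]]|)%N.
Proof.
apply: leq_trans (leq_card_setU _ _); apply/subset_leq_card/subsetP => e.
by rewrite !inE => /andP[-> ->]; case: [disjoint _ & _].
Qed.

(** With two small parts, all edges at [v] except (zeta + 2 beta) n^(p+1) would lie in the other m-1
    parts. By Pascal's rule at least one of the [C] color patterns is then lost, a deficit of about
    [L ^- p.+1] that [degree_gap] rules out. *)
Lemma unique_small_part k k' : ~~ big_part k -> ~~ big_part k' -> k = k'.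
Proof.
rewrite /big_part -!ltNge => small_k small_k'; apply/eqP/negP => /negP nkk'.
pose X := (link_vertices :&: part k) :|: (link_vertices :&: part k').
have vpart j : (v \in part j) = false by rewrite /part inE /U !inE eqxx.
have vX : v \notin W :|: X by rewrite !in_setU !in_setI !vpart !andbF !orbF (negbTE vW).
have WX : #|W :|: X|%:R <= (zeta + 2 * beta) * N.
  apply: le_trans (_ : (#|W| + (#|link_vertices :&: part k| + #|link_vertices :&: part k'|))%:R <= _).
    by rewrite ler_nat (leq_trans (leq_card_setU _ _)) // leq_add2l leq_card_setU.
  by rewrite !natrD; move: card_W; lra.
have le1 := edges_meeting_le vX WX.
have := deg_split (W :|: X); rewrite -(ler_nat R) natrD.
set D := [set e in E | (v \in e) && [disjoint e & _]] => le2.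
have le3 : #|D|%:R <= elem_sym (fun k => #|part k|%:R : R) (~: [set k; k']) p.+1.
  rewrite -(@card_in_imset _ _ (fun e : {set V} => e :\ v) D); last first.
    move=> e f; rewrite !inE => /and3P[_ ve _] /and3P[_ vf _] eef.
    by rewrite -(setD1K ve) eef setD1K.
  apply: card_le_elem_sym => _ /imsetP[e + ->]; rewrite inE => /and3P[eE ve eWX].
  have [eW eX] : [disjoint e & W] /\ [disjoint e & X].
    by split; apply: disjointWr eWX; rewrite ?subsetUl ?subsetUr.
  have [sU inj] := edge_v eE eW ve; split=> //.
    by have := cardsD1 v e; rewrite ve E_uniform // => -[].
  apply/subsetP => _ /imsetP[x xe ->]; have /setD1P[_ xe'] := xe.
  have xL : x \in link_vertices by rewrite inE; apply/exists_inP; exists e; rewrite ?eW ?ve.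
  have := disjointFr eX xe'; have xU := subsetP sU x xe.
  rewrite in_setU !in_setI xL /= /part ![x \in [set _ in U | _]]inE xU /=.
  by move=> h; rewrite !inE h.
have le4 := le_trans le3 (elem_sym_part_le _).
have cB : #|~: [set k; k']| = m.-1.
  by have := cardsC [set k; k']; rewrite cards2 nkk' card_ord add2n => -[/(congr1 predn)].
have le5 : 'C(m.-1, p.+1)%:R <= C - 1.
  rewrite -C_def lerBrDr natr1 ler_nat; case: (m) pm => // m' pm'.
  by rewrite binS /= -addn1 leq_add2l bin_gt0.
rewrite cB in le4.
have pos : 0 <= L ^- p.+1 + p.+1%:R * eta.
  by rewrite addr_ge0 ?mulr_ge0 ?ler0n // invr_ge0 exprn_ge0 // ltW.
have Np : 0 < N ^+ p.+1 by rewrite exprn_gt0.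
have le6 := ler_wpM2r (ltW Np) (ler_wpM2r pos le5).
have le7 : C / L ^+ p.+1 - zeta <= zeta + 2 * beta + (C - 1) * (L ^- p.+1 + p.+1%:R * eta).
  rewrite -(ler_pM2r Np); have := deg_ge vW; lra.
have : 2 * beta <= L * beta by rewrite ler_wpM2r ?(ltW beta_gt0) // -L_def (ler_nat _ 2) ltnS (leq_ltn_trans _ pm).
have : 0 <= p.+1%:R * eta by rewrite mulr_ge0 ?ler0n.
by move: degree_gap le7; lra.
Qed.

Lemma exists_edge : exists2 e, e \in E & [disjoint e & W] && (v \in e).
Proof.
have := deg_split W; rewrite -(ler_nat R) natrD; set D := [set e in E | (v \in e) && [disjoint e & _]] => le2.
have le1 := edges_meeting_le vW card_W.
suff /card_gt0P[e] : (0 < #|D|)%N.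
  by rewrite inE => /and3P[eE ve eW]; exists e; rewrite ?eW.
rewrite -(ltr0n R) -(ltr_pM2r (exprn_gt0 p.+1 N_gt0)) mul0r.
have Np : 0 < N ^+ p.+1 by rewrite exprn_gt0.
have Lp : 0 < L ^- p.+1 by rewrite invr_gt0 exprn_gt0.
have : L ^- p.+1 <= C * L ^- p.+1 by rewrite ler_peMl // ltW.
have : 0 <= L * beta + C * p.+1%:R * eta.
  by rewrite addr_ge0 ?mulr_ge0 ?ler0n // ltW // (lt_le_trans ltr01).
move=> h1 h2; have h3 : 0 < C / L ^+ p.+1 - 2 * zeta by move: degree_gap; lra.
have := mulr_gt0 h3 Np; have := deg_ge vW => h4 h5.
by rewrite mulr_gt0 //; lra.
Qed.

(** [v] receives the color of the unique part where it has few neighbours. A vertex [u] on an edge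
    through [v] has, by [not_all_big], a small part other than its own; by uniqueness it is this
    one, so [u] has a different color. [exists_edge] supplies a first such part. *)
Lemma vertex_extension : exists chi' : V -> 'I_m.+1, proper E W chi'.
Proof.
have [e0 e0E /andP[e0W ve0]] := exists_edge.
have small_of e u : e \in E -> [disjoint e & W] -> v \in e -> u \in e -> u != v ->
    exists2 k, k != chi u & ~~ big_part k.
  move=> eE eW ve ue uv; apply: not_all_big => //.
  by rewrite inE; apply/exists_inP; exists e; rewrite ?eW ?ve.
have [u0 /setD1P[u0v u0e]] : exists u, u \in e0 :\ v.
  by apply/card_gt0P; have := cardsD1 v e0; rewrite ve0 E_uniform // add1n => -[<-].
have [k0 _ small_k0] := small_of e0 u0 e0E e0W ve0 u0e u0v.
exists (upd chi v k0) => e eE eW.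
have [ve|ve] := boolP (v \in e); last first.
  have nv x : x \in e -> (x == v) = false by apply: contraTF => /eqP ->.
  move=> x y xe ye; rewrite /upd !nv //; apply: (chi_proper eE) => //.
  by rewrite disjoint_setU1r ve.
have [_ inj] := edge_v eE eW ve.
have nk0 x : x \in e -> x != v -> chi x <> k0.
  move=> xe xv exk; have [k kx small_k] := small_of e x eE eW ve xe xv.
  by move: kx; rewrite exk (unique_small_part small_k small_k0) eqxx.
move=> x y xe ye; rewrite /upd; have [->|xv] := eqVneq x v; have [->|yv] := eqVneq y v => //.
- by move/esym/(nk0 y ye yv).
- by move/(nk0 x xe xv).
- by apply: inj; rewrite !inE ?xv ?yv.
Qed.

End Extension.

(** Chosen in the order [beta], [eta], [zeta]: [beta] spends a quarter of the gap [B], [kappa] is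
    the budget that [mu] may use of [beta ^+ m.+1], and [zeta] is small even against
    [eta ^+ p.+1]. *)
Lemma extension_constants (R : realFieldType) (p m : nat) (C L : R) :
  (p < m)%N -> 1 <= C -> m.+1%:R = L ->
  exists beta eta zeta : R, [/\ 0 < beta, 0 < eta, 0 < zeta &
    [/\ 2 * zeta * m%:R ^+ p.+1 < eta ^+ p.+1,
        m%:R * eta + zeta + beta <= L^-1,
        p.+3%:R * (C * p.+1%:R * eta + 2 * zeta) < beta ^+ m.+1 &
        2 * zeta + L * beta + C * p.+1%:R * eta < L ^- p.+1]].
Proof.
move=> pm C1 Ldef; have C0 : 0 < C by lra.
have L1 : 1 <= L by rewrite -Ldef ler1n.
have L0 : 0 < L by lra.
have m1 : 1 <= m%:R :> R by rewrite ler1n; case: (m) pm.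
have m0 := lt_le_trans ltr01 m1.
have q1 : 1 <= p.+1%:R :> R by rewrite ler1n.
have q0 := lt_le_trans ltr01 q1.
have r1 : 1 <= p.+3%:R :> R by rewrite ler1n.
pose B := L ^- p.+1; pose beta := B / (4 * L).
have B0 : 0 < B by rewrite invr_gt0 exprn_gt0.
have Lbeta : L * beta = B / 4 by rewrite /beta; field; apply: lt0r_neq0.
have beta0 : 0 < beta by rewrite divr_gt0 // mulr_gt0.
have B1 : B <= 1 by rewrite invf_le1 ?exprn_gt0 // exprn_ege1.
have betaL : 4 * beta <= L^-1.
  rewrite (_ : 4 * beta = B * L^-1); last by rewrite /beta; field; apply: lt0r_neq0.
  by rewrite ler_piMl // invr_ge0 ltW.
have beta1 : beta <= 1.
  have : L^-1 <= 1 by rewrite invf_le1.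
  lra.
pose kappa := beta ^+ m.+1 / (4 * p.+3%:R).
have kappa0 : 0 < kappa by rewrite divr_gt0 ?exprn_gt0 // mulr_gt0 //; lra.
have kappaE : p.+3%:R * kappa = beta ^+ m.+1 / 4.
  by rewrite /kappa; field; apply: lt0r_neq0; lra.
have betam : beta ^+ m.+1 <= beta by rewrite exprS ler_piMr ?exprn_ile1 // ltW.
have kappa_le : 4 * kappa <= beta.
  have : kappa <= p.+3%:R * kappa by rewrite ler_peMl // ltW.
  rewrite kappaE; lra.
pose eta := kappa / (C * p.+1%:R * m%:R).
have eta0 : 0 < eta by rewrite divr_gt0 // !mulr_gt0.
have cancel1 (c q d k : R) : c != 0 -> q != 0 -> d != 0 -> c * q * (k / (c * q * d)) = k / d.
  by move=> *; field; apply/and3P.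
have cancel2 (c d k : R) : c != 0 -> d != 0 -> d * (k / (c * d)) = k / c.
  by move=> *; field; apply/andP.
have eta1 : C * p.+1%:R * eta <= kappa.
  rewrite /eta cancel1 ?lt0r_neq0 //.
  by rewrite ler_pdivrMr // ler_peMr // ltW.
have eta2 : m%:R * eta <= kappa.
  rewrite /eta cancel2 ?lt0r_neq0 ?mulr_gt0 //.
  have C2 : 1 <= C * p.+1%:R by rewrite mulr_ege1.
  by rewrite ler_pdivrMr ?mulr_gt0 // ler_peMr // ltW.
have mq : 0 < m%:R ^+ p.+1 :> R by rewrite exprn_gt0.
have etaq : 0 < eta ^+ p.+1 by rewrite exprn_gt0.
pose z1 := eta ^+ p.+1 / (4 * m%:R ^+ p.+1).
have z10 : 0 < z1 by rewrite divr_gt0 // mulr_gt0.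
have z1E : z1 * m%:R ^+ p.+1 = eta ^+ p.+1 / 4 by rewrite /z1; field; apply: lt0r_neq0.
pose zeta := Num.min (kappa / 2) z1.
have zeta0 : 0 < zeta by rewrite lt_min z10 divr_gt0.
have zeta1 : zeta <= kappa / 2 by rewrite ge_min lexx.
have zeta2 : zeta <= z1 by rewrite ge_min lexx orbT.
exists beta, eta, zeta; split=> //; split.
- have := ler_wpM2r (ltW mq) zeta2; rewrite z1E; lra.
- lra.
- apply: le_lt_trans (_ : p.+3%:R * (2 * kappa) < _).
    by rewrite ler_pM2l; lra.
  have : 0 < beta ^+ m.+1 by rewrite exprn_gt0.
  rewrite mulrCA kappaE; lra.
- have : beta <= L * beta by rewrite ler_peMl // ltW.
  rewrite Lbeta -/B; lra.
Qed.

(** The linear term has to be exact, because it cancels in [card_low_degree_le]; a crude quadratic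
    term is enough. *)
Lemma exprB_le (R : realFieldType) (t : R) n : 0 <= t <= 1 ->
  (1 - t) ^+ n <= 1 - n%:R * t + n%:R ^+ 2 * t ^+ 2.
Proof.
move=> /andP[t0 t1]; elim: n => [|n IHn]; first by rewrite expr0 expr0n !mul0r; lra.
have t1' : 0 <= 1 - t by lra.
have n0 := ler0n R n; rewrite exprSr -addn1 natrD.
have := ler_wpM2r t1' IHn; set x := _ ^+ n; set k := n%:R : R.
have : 0 <= k ^+ 2 * t ^+ 2 * t by rewrite !mulr_ge0 ?sqr_ge0.
have : 0 <= k * t ^+ 2 by rewrite mulr_ge0 ?sqr_ge0.
have : 0 <= t ^+ 2 by rewrite sqr_ge0.
lra.
Qed.

(** * Stability *)

Lemma lam_degree (R : realFieldType) p m :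
  p.+2%:R * lam R m.+1 p.+2 = 'C(m, p.+1)%:R / m.+1%:R ^+ p.+1.
Proof.
rewrite /lam mulrA -natrM -mul_bin_diag natrM exprS /=.
have : m.+1%:R != 0 :> R by rewrite pnatr_eq0.
move: (m.+1%:R : R) => x x0; rewrite invfM mulrACA mulfV // mul1r //.
Qed.

Section Stability.

Variables (R : realFieldType) (p m : nat).
Hypothesis pm : (p < m)%N.
Let c : R := 'C(m, p.+1)%:R / m.+1%:R ^+ p.+1.
Let la : R := lam R m.+1 p.+2.

Variables (F : ugraph p.+2) (s0 : R).
Hypothesis s0_lt : s0 < lam R m.+1 p.+2.
Hypothesis lagrangian_le : forall G : ugraph p.+2, family_free (eq F) G ->
  ~ is_colorable (complete_ugraph p.+2 m.+1) G ->
  forall x : vertex G -> R, (forall i, 0 <= x i) -> \sum_i x i = 1 ->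
  \sum_(e in edges G) \prod_(i in e) x i <= s0.

Definition low_degree (zeta : R) (V : finType) (E : {set {set V}}) : {set V} :=
  [set x | (deg E x)%:R < (c - zeta) * #|V|%:R ^+ p.+1].

(** Removing t n low-degree vertices destroys at most t (c - zeta) n^r edges, with r = p+2, and
    leaves at most la (1-t)^r n^r. Since c = r la, the linear terms cancel, and the loss t zeta
    beats the error (r t)^2: too few edges in total. *)
Lemma card_low_degree_le (zeta delta eps : R) (V : finType) (E : {set {set V}}) :
  0 < delta -> p.+2%:R ^+ 2 * delta <= zeta / 2 -> eps < delta * zeta / 4 ->
  2 <= delta * #|V|%:R -> (forall e, e \in E -> #|e| = p.+2) -> core_free F E ->
  (la - eps) * #|V|%:R ^+ p.+2 <= #|E|%:R ->
  #|low_degree zeta E|%:R <= delta * #|V|%:R.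
Proof.
set N : R := #|V|%:R; move=> delta0 delta_le eps_lt N_ge hE cfE E_ge.
rewrite leNgt; apply/negP => Z_gt.
(* Only part of the set is removed, so that [t] stays at most [delta] and the quadratic error small;
   [2 <= delta * n] leaves an integer between delta n/2 and delta n. *)
have exk : exists k : nat, delta * N / 2 <= k%:R.
  by exists #|low_degree zeta E|; lra.
pose k := ex_minn exk.
have [k_ge k_min] : delta * N / 2 <= k%:R /\ forall j : nat, delta * N / 2 <= j%:R -> (k <= j)%N.
  by rewrite /k; case: ex_minnP.
have k_le : k%:R <= delta * N.
  case ek : k => [|j]; first lra.
  have : j%:R < delta * N / 2.
    by rewrite ltNge; apply/negP => /k_min; rewrite ek ltnn.
  rewrite -[j.+1]addn1 natrD; lra.
have [||Z' _ /andP[sZ /eqP cZ]] := @ex_subset_card _ set0 (low_degree zeta E) k.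
- exact: sub0set.
- by rewrite cards0 leq0n -(ler_nat R) (le_trans k_le) // ltW.
have split : (#|E| <= #|[set e in E | e \subset ~: Z']| + \sum_(x in Z') deg E x)%N.
  apply: leq_trans (leq_trans (leq_card_setU _ _) (leq_add (leqnn _) (card_bigcup_le _ _))).
  apply/subset_leq_card/subsetP => e eE; rewrite inE inE eE /=.
  rewrite -disjoints_subset; have [//|/pred0Pn[x /andP[/= xe xZ]]] := boolP [disjoint e & Z'].
  by apply/bigcupP; exists x => //; rewrite inE eE.
have N0 : 0 < N by rewrite -(pmulr_rgt0 _ delta0); lra.
pose t := k%:R / N; have tN : k%:R = t * N by rewrite divfK ?gt_eqF.
have cZC : #|~: Z'|%:R = (1 - t) * N.
  have := cardsC Z'; rewrite cZ => /(congr1 (fun n => n%:R : R)); rewrite natrD -/N tN; lra.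
have t0 : 0 <= t by rewrite divr_ge0 ?ler0n ?ltW.
have t1 : t <= 1.
  have : 0 <= (1 - t) * N by rewrite -cZC ler0n.
  by rewrite pmulr_lge0 // subr_ge0.
have le1 := core_free_card_sub_le (ltn0Sn m) s0_lt lagrangian_le (~: Z') hE cfE.
have le2 : \sum_(x in Z') (deg E x)%:R <= k%:R * ((c - zeta) * N ^+ p.+1).
  rewrite -cZ mulr_natl -sumr_const; apply: ler_sum => x /(subsetP sZ).
  by rewrite inE => /ltW.
have cla : p.+2%:R * la = c by exact: lam_degree.
have Nr : 0 < N ^+ p.+2 by rewrite exprn_gt0.
have le3 : la - eps <= la * (1 - t) ^+ p.+2 + t * (c - zeta).
  rewrite -(ler_pM2r Nr); apply: le_trans E_ge _.
  apply: le_trans (_ : (#|[set e in E | e \subset ~: Z']| + \sum_(x in Z') deg E x)%:R <= _).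
    by rewrite ler_nat.
  rewrite natrD natr_sum mulrDl lerD //.
    by rewrite -mulrA -exprMn -cZC.
  by apply: le_trans le2 _; rewrite tN [N ^+ p.+2]exprS le_eqVlt; apply/orP; left; apply/eqP; ring.
have la0 : 0 <= la by exact: lam_ge0.
have la1 : la <= 1 by exact: lam_le1.
have le4 : la * (1 - t) ^+ p.+2 <= la * (1 - p.+2%:R * t + p.+2%:R ^+ 2 * t ^+ 2).
  by rewrite ler_wpM2l // exprB_le // t0.
have r2 : 0 <= p.+2%:R ^+ 2 :> R by rewrite sqr_ge0.
have le5 : la * (p.+2%:R ^+ 2 * t ^+ 2) <= p.+2%:R ^+ 2 * t ^+ 2.
  by rewrite ler_piMl // mulr_ge0 // sqr_ge0.
have t_ge : delta / 2 <= t by rewrite -(ler_pM2r N0) -tN; lra.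
have t_le : t <= delta by rewrite -(ler_pM2r N0) -tN.
have le6 : t * (p.+2%:R ^+ 2 * t) <= t * (zeta / 2).
  by rewrite ler_wpM2l // (le_trans _ delta_le) // ler_wpM2l.
have zeta0 : 0 <= zeta by move: (mulr_ge0 r2 (ltW delta0)); lra.
have le7 := ler_wpM2r zeta0 t_ge.
move: le3 le4 le5 le6; rewrite -cla; set r := p.+2%:R; clearbody la; clear -le7 eps_lt.
move: r ((1 - t) ^+ p.+2) => r u; lra.
Qed.

Section Extendable.

Variables (zeta delta eps : R).
Hypothesis delta_gt0 : 0 < delta.
Hypothesis delta_zeta : p.+2%:R ^+ 2 * delta <= zeta / 2.
Hypothesis delta_zeta4 : delta * 4 <= zeta.
Hypothesis eps_lt : eps < delta * zeta / 4.
Hypothesis eps_gap : eps < la - s0.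
Hypothesis extendable : forall (V : finType) (E : {set {set V}}) (W : {set V}) v
    (chi : V -> 'I_m.+1),
  (forall e, e \in E -> #|e| = p.+2) -> core_free F E -> v \notin W ->
  proper E (v |: W) chi -> #|v |: W|%:R <= zeta * #|V|%:R ->
  (forall x, x \notin W -> (c - zeta) * #|V|%:R ^+ p.+1 <= (deg E x)%:R) ->
  exists chi' : V -> 'I_m.+1, proper E W chi'.

Lemma proper_shrink (V : finType) (E : {set {set V}}) (W : {set V}) (chi : V -> 'I_m.+1) :
  (forall e, e \in E -> #|e| = p.+2) -> core_free F E ->
  low_degree zeta E \subset W -> #|W|%:R <= zeta * #|V|%:R -> proper E W chi ->
  exists chi' : V -> 'I_m.+1, proper E (low_degree zeta E) chi'.
Proof.
move=> hE cfE; have [k] := ubnP #|W|; elim: k W chi => // k IHk W chi ltWk ZW cW chiP.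
have [eWZ|] := eqVneq (low_degree zeta E) W; first by exists chi; rewrite eWZ.
rewrite eqEsubset ZW /= => /subsetPn[v vW vZ].
have cWv := cardsD1 v W; rewrite vW add1n in cWv.
have [||||||chi' chi'P] := @extendable V E (W :\ v) v chi => //.
- by rewrite !inE eqxx.
- by rewrite setD1K.
- by rewrite setD1K.
- move=> x xW; have : x \notin low_degree zeta E.
    apply: contra xW => xZ; rewrite !inE (subsetP ZW) // andbT.
    by apply: contraNneq vZ => <-.
  by rewrite inE -leNgt.
apply: (IHk (W :\ v) chi') => //.
- by move: ltWk; rewrite cWv ltnS.
- apply/subsetP => x xZ; rewrite !inE (subsetP ZW) // andbT.
  by apply: contraNneq vZ => <-.
- by apply: le_trans cW; rewrite ler_nat cWv.
Qed.

Lemma proper_off_low_degree (V : finType) (E : {set {set V}}) :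
  2 <= delta * #|V|%:R -> (forall e, e \in E -> #|e| = p.+2) -> core_free F E ->
  forall phi : V -> V, (la - eps) * #|V|%:R ^+ p.+2 <= #|pullback p.+2 E phi|%:R ->
  exists chi : V -> 'I_m.+1, proper (pullback p.+2 E phi) (low_degree zeta (pullback p.+2 E phi)) chi.
Proof.
move=> N_ge hE cfE; apply: (symmetrization_ind (E := E) (r := p.+2)).
  move=> phi cov E_ge; case: (two_covering_dichotomy lagrangian_le hE cfE cov).
    move=> [chi chiP]; exists chi => e eE _; apply: chiP => //.
    by rewrite disjoint_sym disjoints_subset sub0set.
  move/(le_trans E_ge); have N0 : 0 < #|V|%:R ^+ p.+2 :> R.
    by rewrite exprn_gt0 // -(pmulr_rgt0 _ delta_gt0); lra.
  by rewrite ler_pM2r //; move: eps_gap; lra.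
move=> phi x y le_e IH E_ge; set D := pullback p.+2 E phi.
set D' := pullback p.+2 E (upd phi x (phi y)) in le_e IH.
have E'_ge : (la - eps) * #|V|%:R ^+ p.+2 <= #|D'|%:R.
  by apply: le_trans E_ge _; rewrite ler_nat.
have [chi chiP] := IH E'_ge.
have cZ := card_low_degree_le delta_gt0 delta_zeta eps_lt N_ge
  (@pullback_uniform _ _ _ _ _) (core_free_pullback hE cfE) E_ge.
have cZ' := card_low_degree_le delta_gt0 delta_zeta eps_lt N_ge
  (@pullback_uniform _ _ _ _ _) (core_free_pullback hE cfE) E'_ge.
(* [D] and [D'] agree on sets avoiding [x], so [chi] is proper for [D] off this set. Its size is at
   most 1 + 2 delta n, hence below zeta n; [low_degree zeta D] is added because [proper_shrink] can
   only shrink down to it. *)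
apply: (@proper_shrink V D (x |: (low_degree zeta D :|: low_degree zeta D')) chi).
- exact: pullback_uniform.
- exact: core_free_pullback.
- by rewrite subsetU // subsetUl orbT.
- apply: le_trans (_ : (1 + (#|low_degree zeta D| + #|low_degree zeta D'|))%:R <= _).
    rewrite ler_nat (leq_trans (leq_card_setU _ _)) // cards1 leq_add2l leq_card_setU //.
  rewrite !natrD; have N0 : 0 <= #|V|%:R :> R by rewrite ler0n.
  have := ler_wpM2r N0 delta_zeta4; lra.
- move=> e; rewrite inE => /andP[ce eE]; rewrite disjoint_setU1r => /andP[xe eZ].
  apply: chiP; last by apply: disjointWr eZ; rewrite subsetUr.
  rewrite inE ce /= (_ : _ @: e = phi @: e) //; apply: eq_in_imset => z ze.
  by rewrite /upd; case: eqP ze xe => // -> ->.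
Qed.

Lemma proper_of_min_degree (V : finType) (E : {set {set V}}) :
  2 <= delta * #|V|%:R -> 0 <= eps -> eps <= zeta ->
  (forall e, e \in E -> #|e| = p.+2) -> core_free F E ->
  (forall x, (c - eps) * #|V|%:R ^+ p.+1 <= (deg E x)%:R) ->
  exists chi : V -> 'I_m.+1, proper E set0 chi.
Proof.
move=> N_ge eps0 eps_zeta hE cfE deg_ge; have N0 : 0 <= #|V|%:R :> R by rewrite ler0n.
have [] := @proper_off_low_degree V E N_ge hE cfE id; rewrite pullback_id //.
  have r0 : 0 < p.+2%:R :> R by rewrite ltr0n.
  rewrite -(ler_pM2l r0) -natrM -(sum_deg hE) natr_sum.
  apply: le_trans (_ : \sum_(x : V) (c - eps) * #|V|%:R ^+ p.+1 <= _); last exact: ler_sum.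
  (* Dividing the degree sum by r turns [eps] into eps/r, which is relaxed back to [eps]. *)
  have gen (k l x N e : R) : 1 <= k -> 0 <= x -> 0 <= N -> 0 <= e ->
      k * ((l - e) * (N * x)) <= N * ((k * l - e) * x).
    move=> k1 x0 N0' e0; rewrite -subr_ge0 [leRHS](_ : _ = N * x * (e * (k - 1))).
      by rewrite !mulr_ge0 // subr_ge0.
    by ring.
  have Nx0 : 0 <= #|V|%:R ^+ p.+1 :> R by rewrite exprn_ge0.
  rewrite sumr_const -[leRHS]mulr_natl /c -lam_degree -/la exprS.
  by apply: gen => //; rewrite ler1n.
move=> chi chiP; exists chi; rewrite (_ : set0 = low_degree zeta E) //.
apply/esym/setP => x; rewrite !inE; apply/negbTE; rewrite -leNgt.
by apply: le_trans (deg_ge x); rewrite ler_wpM2r ?exprn_ge0 // lerB.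
Qed.

End Extendable.

Variables (a : vertex F) (T : {set vertex F}).
Hypotheses (card_F : #|vertex F| = m.+2) (aT : a \notin T) (T_gt0 : (0 < #|T|)%N)
  (T_le : (#|T| <= p.+1)%N).
Hypothesis edges_a : forall e, e \in edges F -> a \in e -> e = a |: T.
Hypothesis edges_na : forall e, e \in edges F -> a \notin e -> (#|e :&: T| <= 1)%N.

Theorem core_free_degree_stable : exists eps delta : R, [/\ 0 < eps, 0 < delta &
  forall (V : finType) (E : {set {set V}}),
  2 <= delta * #|V|%:R -> (forall e, e \in E -> #|e| = p.+2) -> core_free F E ->
  (forall x, (c - eps) * #|V|%:R ^+ p.+1 <= (deg E x)%:R) ->
  exists chi : V -> 'I_m.+1, proper E set0 chi].
Proof.
have C1 : 1 <= 'C(m, p.+1)%:R :> R by rewrite ler1n bin_gt0.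
have [beta [eta [zeta [beta0 eta0 zeta0 [h1 h2 h3 h4]]]]] := extension_constants pm C1 (erefl _).
have r2 : 1 <= p.+2%:R ^+ 2 :> R by rewrite exprn_ege1 // ler1n.
have r20 := lt_le_trans ltr01 r2.
pose delta := zeta / (4 * p.+2%:R ^+ 2).
have delta0 : 0 < delta by rewrite divr_gt0 // mulr_gt0.
have deltaE : p.+2%:R ^+ 2 * delta = zeta / 4.
  have gen (x y : R) : 0 < x -> x * (y / (4 * x)) = y / 4.
    by move=> x0; field; rewrite gt_eqF.
  exact: gen.
have delta4 : delta * 4 <= zeta.
  have : delta <= p.+2%:R ^+ 2 * delta by rewrite ler_peMl // ltW.
  rewrite deltaE; lra.
(* The three bounds put degrees above the low-degree threshold, meet [card_low_degree_le], and
   exclude the sparse outcome of the dichotomy. *)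
pose eps := Num.min (zeta / 2) (Num.min (delta * zeta / 8) ((la - s0) / 2)).
have dz : 0 < delta * zeta by rewrite mulr_gt0.
have eps0 : 0 < eps.
  by rewrite !lt_min; apply/and3P; split; rewrite divr_gt0 // subr_gt0.
have eps1 : eps <= zeta / 2 by rewrite ge_min lexx.
have eps2 : eps <= delta * zeta / 8 by rewrite !ge_min lexx orbT.
have eps3 : eps <= (la - s0) / 2 by rewrite !ge_min lexx !orbT.
exists eps, delta; split=> // V E N_ge hE cfE deg_ge.
have gap : 0 < la - s0 by rewrite subr_gt0.
have eps4 : eps < la - s0 by apply: le_lt_trans eps3 _; rewrite ltr_pdivrMr // ltr_pMr // ltr1n.
have eps5 : eps < delta * zeta / 4 by lra.
have delta2 : p.+2%:R ^+ 2 * delta <= zeta / 2 by rewrite deltaE; lra.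
apply: (@proper_of_min_degree zeta delta eps) => //; [|exact: ltW|lra].
move=> {E hE cfE deg_ge N_ge} {}V E W v chi hE cfE vW chiP cW deg_ge.
by apply: (vertex_extension pm (erefl _) (erefl _) (erefl _) hE chiP beta0 (ltW eta0) (ltW zeta0) cW deg_ge h1 h2 h3 card_F aT).
Qed.

End Stability.

(** * Weak expansions and blowups *)

Lemma card_edge (r : nat) (H : ugraph r) e : e \in edges H -> #|e| = r.
Proof. by move=> eH; apply/eqP/(forall_inP (edges_uniform H)). Qed.

Lemma core_free_of_family_free (r : nat) (F H : ugraph r) :
  family_free (weak_expansions F) H -> core_free F (edges H).
Proof.
move=> free g gI gE gC.
pose S (p : {set vertex F}) := odflt set0 [pick e in edges H | g @: p \subset e].
have SP p : p \in uncovered_pairs F -> S p \in edges H /\ g @: p \subset S p.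
  rewrite inE inE => /andP[_ /cards2P[x [y [nxy ->]]]].
  have /coveredP[e eH /andP[xe ye]] := gC x y nxy.
  rewrite /S; case: pickP => [f /andP[fH sf] //|/(_ e)].
  by rewrite eH imsetU1 imset_set1 subUset !sub1set xe ye.
(* A weak expansion has no spare vertices, so the subgraph is built on exactly the vertices it
   uses. *)
pose X := [set g x | x : vertex F] :|: \bigcup_(p in uncovered_pairs F) S p.
pose K : finType := {x : vertex H | x \in X}.
have gX x : g x \in X by rewrite inE imset_f.
pose iota x : K := Sub (g x) (gX x).
pose S' (p : {set vertex F}) := [set k : K | val k \in S p].
have vS p : p \in uncovered_pairs F -> val @: S' p = S p.
  move=> pU; apply/setP => z; apply/imsetP/idP => [[k /[!inE] ke ->] //|ze].
  have zX : z \in X by rewrite inE; apply/orP; right; apply/bigcupP; exists p.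
  by exists (Sub z zX : K); rewrite ?inE.
have viota (e : {set vertex F}) : val @: (iota @: e) = g @: e by rewrite -imset_comp.
pose EG := [set iota @: e | e : {set vertex F} in edges F]
           :|: [set S' p | p : {set vertex F} in uncovered_pairs F].
have vEG e : e \in EG -> val @: e \in edges H.
  rewrite inE => /orP[/imsetP[f fF ->]|/imsetP[p pU ->]]; first by rewrite viota gE.
  by rewrite vS //; case: (SP p pU).
have uG : [forall e in EG, #|e| == r].
  by apply/forall_inP => e /vEG/card_edge <-; rewrite card_imset //; exact: val_inj.
apply: (free (MkUGraph uG)); last by exists val => //; exact: val_inj.
exists iota, S'; split=> //.
- by move=> x y /(congr1 val) /= /gI.
- move=> p pU; apply/subsetP => _ /imsetP[x xp ->]; rewrite inE /=.
  by case: (SP p pU) => _ /subsetP; apply; apply: imset_f.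
- apply/setP => k; rewrite !inE; have := valP k; rewrite inE => /orP[|].
    move=> /imsetP[x _ ex]; apply/esym/orP; left; apply/imsetP; exists x => //.
    exact: val_inj.
  move=> /bigcupP[p pU kS]; apply/esym/orP; right; apply/bigcupP; exists p => //.
  by rewrite inE.
Qed.

Lemma blowup_inj (r l : nat) (H : ugraph r) (psi : vertex H -> 'I_l) e :
  (forall E : {set vertex H}, #|E| = r ->
    (E \in edges H) = (psi @: E \in edges (complete_ugraph r l))) ->
  e \in edges H -> {in e &, injective psi}.
Proof.
move=> psiP eH; have ce := card_edge eH; move: eH; rewrite psiP // inE andbT => /eqP cpsi.
by apply/imset_injP; rewrite cpsi ce.
Qed.

(** Any two vertices of F share an edge of a weak expansion, and [psi] is injective on edges; so l+1
    vertices would get distinct values among l. *)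
Lemma blowup_family_free (r l : nat) (F H : ugraph r) :
  #|vertex F| = l.+1 -> is_blowup (complete_ugraph r l) H ->
  family_free (weak_expansions F) H.
Proof.
move=> cF [psi psiP] G [iota [S [iotaI sS eG vG]]] [h hI hE].
suff /leq_card : injective (fun x => psi (h (iota x)) : 'I_l) by rewrite card_ord cF ltnn.
move=> x y exy; apply/eqP; apply: contraT => nxy.
have [e [eE xe ye]] : exists e, [/\ e \in edges G, iota x \in e & iota y \in e].
  have [cov|ncov] := boolP ([set x; y] \in pair_shadow F).
    move: cov; rewrite inE => /andP[_ /exists_inP[e eF /subsetP sxy]].
    exists (iota @: e); split; last 2 first.
    - by rewrite imset_f // sxy // !inE eqxx.
    - by rewrite imset_f // sxy // !inE eqxx orbT.
    - by rewrite eG inE imset_f.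
  have pU : [set x; y] \in uncovered_pairs F by rewrite inE ncov inE cards2 nxy.
  exists (S [set x; y]); split.
  - by rewrite eG inE orbC imset_f.
  - by apply: (subsetP (sS _ pU)); rewrite imset_f // !inE eqxx.
  - by apply: (subsetP (sS _ pU)); rewrite imset_f // !inE eqxx orbT.
case/eqP: nxy; apply/iotaI/hI/(blowup_inj psiP (hE e eE)) => //; exact: imset_f.
Qed.

(* If F has an isolated vertex a, take for T any other singleton; if F lies in
   B(r, l+1), let a and T correspond to 1 and {2, ..., r}. *)
Lemma exists_pivot (p m : nat) (F : ugraph p.+2) : #|vertex F| = m.+2 ->
  (exists v : vertex F, isolated_vertex v) \/ is_subgraph F (Bgraph p.+2 m.+2) ->
  (p < m)%N ->
  exists (a : vertex F) (T : {set vertex F}), [/\ a \notin T, (0 < #|T|)%N, (#|T| <= p.+1)%N,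
    forall e, e \in edges F -> a \in e -> e = a |: T &
    forall e, e \in edges F -> a \notin e -> (#|e :&: T| <= 1)%N].
Proof.
move=> cF [[a isoa]|[f fI fE]] pm.
  have /card_gt0P[b] : (0 < #|~: [set a]|)%N by rewrite cardsC1 cF.
  rewrite !inE => ba; exists a, [set b]; split.
  - by rewrite inE eq_sym.
  - by rewrite cards1.
  - by rewrite cards1.
  - by move=> e eF ae; have := isoa e eF; rewrite ae.
  - by move=> e _ _; rewrite (leq_trans (subset_leq_card (subsetIr _ _))) ?cards1.
have [f' fK f'K] : bijective f by apply: inj_card_bij => //; rewrite cF /= card_ord.
pose a := f' ord0; pose Q := [set i : 'I_m.+2 | (0 < i < p.+2)%N].
have f'I := can_inj f'K.
have fQ (e : {set vertex F}) : f @: (e :&: f' @: Q) = f @: e :&: Q.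
  rewrite imsetI; last by move=> x y _ _; apply: fI.
  by rewrite -imset_comp (eq_imset (g := id)) ?imset_id.
have fa (e : {set vertex F}) : (a \in e) = (ord0 \in f @: e).
  by rewrite -(f'K ord0) mem_imset.
have lt_pm (i : 'I_p.+1) : (i.+1 < m.+2)%N.
  by rewrite ltnS (leq_trans (ltn_ord i)) // (leq_trans pm).
have cQ : #|Q| = p.+1.
  rewrite -(card_ord p.+1) -(@card_imset _ _ (fun i : 'I_p.+1 => inord i.+1 : 'I_m.+2)).
    apply: eq_card => i; rewrite !inE; apply/idP/imsetP => [/andP[i0 ip]|[j _ ->]].
      have jp : (i.-1 < p.+1)%N by rewrite prednK.
      by exists (Ordinal jp) => //; apply: val_inj; rewrite /= inordK prednK.
    by rewrite inordK ?lt_pm //= ltnS.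
  by move=> i j /(congr1 val); rewrite /= !inordK ?lt_pm // => -[/val_inj].
exists a, (f' @: Q); split.
- by rewrite mem_imset // inE.
- by rewrite card_imset // cQ.
- by rewrite card_imset // cQ.
- move=> e eF; rewrite fa => ae; have := fE e eF; rewrite inE => /andP[_ /orP[/eqP ef|]].
    apply: (imset_inj fI); rewrite ef imsetU1 -imset_comp (eq_imset (g := id)) // imset_id f'K.
    by apply/setP => i; rewrite !inE; case: i => [[|i] ?].
  by move=> /andP[/subsetP/(_ _ ae)]; rewrite inE.
- move=> e eF; rewrite fa => ae; rewrite -(card_imset _ fI) fQ.
  have := fE e eF; rewrite inE => /andP[_ /orP[/eqP ef|]].
    by move: ae; rewrite ef inE.
  by case/andP.
Qed.

(** A crude upper bound, needed because [sup] dominates the members of a set only if the set is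
    bounded above. *)
Lemma lagrangian_sum_le1 (R : realFieldType) (r : nat) (G : ugraph r) (x : vertex G -> R) :
  (forall i, 0 <= x i) -> \sum_i x i = 1 -> \sum_(e in edges G) \prod_(i in e) x i <= 1.
Proof.
move=> x0 x1; have [i0 _|no] := pickP (fun _ : vertex G => true); last first.
  have /eqP : (1 : R) = 0 by rewrite -x1 big_pred0.
  by rewrite oner_eq0.
have K0 : (0 < #|vertex G|)%N by apply/card_gt0P; exists i0.
apply: le_trans (_ : elem_sym x [set: vertex G] r <= _).
  rewrite /elem_sym big_mkcond [leRHS]big_mkcond; apply: ler_sum => e _.
  rewrite subsetT /=; case: ifP => [/card_edge->|_]; first by rewrite eqxx.
  by case: ifP => // _; apply: prodr_ge0.
have := maclaurin [set: vertex G] x0 r; rewrite cardsT.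
rewrite (eq_bigl predT) ?x1 ?expr1n ?mulr1; last by move=> k; rewrite inE.
move=> le; rewrite -(ler_pM2l (x := #|vertex G|%:R ^+ r)) ?exprn_gt0 ?ltr0n // mulr1.
by apply: le_trans le _; rewrite -natrX ler_nat bin_le_exp.
Qed.

(** * Balanced blowups *)

Definition balanced (m n : nat) (i : 'I_n) : 'I_m.+1 := inord (i %% m.+1).

Lemma card_balanced_fiber m n (k : 'I_m.+1) :
  (n %/ m.+1 <= #|[set i in [set: 'I_n] | balanced m i == k]|)%N.
Proof.
have lt_n (j : 'I_(n %/ m.+1)) : (j * m.+1 + k < n)%N.
  apply: leq_trans (leq_trunc_div n m.+1); apply: leq_trans (_ : (j.+1 * m.+1 <= _)%N).
    by rewrite mulSn addnC ltn_add2r.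
  by rewrite leq_mul2r ltn_ord orbT.
rewrite -[leqLHS]card_ord -(@card_imset _ _ (fun j : 'I_(n %/ m.+1) => Ordinal (lt_n j))).
  apply/subset_leq_card/subsetP => _ /imsetP[j _ ->]; rewrite !inE /balanced /=.
  by rewrite modnMDl modn_small // inord_val.
by move=> i j /(congr1 val) /= /addIn/eqP; rewrite eqn_pmul2r // => /eqP/val_inj.
Qed.

Lemma card_balanced_blowup m n r :
  ('C(m.+1, r) * (n %/ m.+1) ^ r <=
   #|[set e : {set 'I_n} | (#|e| == r) && (#|@balanced m n @: e| == r)]|)%N.
Proof.
rewrite -[X in 'C(X, r)]card_ord -card_draws -sum_nat_const.
rewrite -[leqRHS]sum1_card (partition_big (fun e : {set 'I_n} => @balanced m n @: e)
  (fun J => J \in [set J : {set 'I_m.+1} | #|J| == r])) /=; last first.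
  by move=> e; rewrite !inE => /andP[].
apply: leq_sum => J; rewrite inE => /eqP cJ.
apply: leq_trans (_ : \prod_(k in J) #|[set i in [set: 'I_n] | balanced m i == k]| <= _)%N.
  by rewrite -cJ -prod_nat_const; apply: leq_prod => k _; apply: card_balanced_fiber.
rewrite -card_transversals sum1_card subset_leq_card //; apply/subsetP => e.
rewrite !inE subsetT /= => /andP[/eqP ce /eqP eJ].
by rewrite unfold_in /= inE ce eJ cJ !eqxx.
Qed.

(** * Limits *)

From mathcomp Require Import all_classical all_reals all_analysis.
Import Order.TTheory GRing.Theory Num.Theory.
Import numFieldNormedType.Exports.
Local Open Scope ring_scope.
Local Open Scope classical_set_scope.

(** The index is shifted to [n.+1], here and below, to keep powers of zero out of the denominators;
    [cvg_shiftS] undoes the shift. *)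
Lemma cvg_truncB_ratio (R : realType) (r : nat) :
  ((n.+1 - r)%N%:R / n.+1%:R : R) @[n --> \oo] --> (1 : R).
Proof.
apply: (@squeeze_cvgr _ _ _ _ (fun n => 1 - r%:R * harmonic n) (fun=> 1)).
- near=> n; rewrite /harmonic /=; have n0 : 0 < n.+1%:R :> R by rewrite ltr0n.
  rewrite ler_pdivlMr // ler_pdivrMr // mul1r ler_nat leq_subr andbT.
  rewrite mulrBl mul1r mulfVK ?gt_eqF // lerBlDr -natrD ler_nat addnC -leq_subLR //.
- rewrite -[X in _ --> X]subr0 -(mulr0 r%:R).
  by apply: cvgB; [exact: cvg_cst|apply: cvgM; [exact: cvg_cst|exact: cvg_harmonic]].
- exact: cvg_cst.
Unshelve. all: end_near. Qed.

Lemma cvg_ffact_ratio (R : realType) (r : nat) :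
  ((n.+1 ^_ r)%N%:R / n.+1%:R ^+ r : R) @[n --> \oo] --> (1 : R).
Proof.
elim: r => [|r IHr].
  under eq_fun do rewrite ffactn0 expr0 divr1; exact: cvg_cst.
rewrite (_ : (fun n => _) = (fun n => ((n.+1 ^_ r)%N%:R / n.+1%:R ^+ r) *
    ((n.+1 - r)%N%:R / n.+1%:R : R))); last first.
  by apply/funext => n; rewrite ffactnSr natrM exprSr invfM mulrACA.
rewrite -[X in _ --> X]mulr1; apply: cvgM => //; exact: cvg_truncB_ratio.
Qed.

Lemma cvg_exp_binomial_ratio (R : realType) (r : nat) :
  (n.+1%:R ^+ r / 'C(n.+1, r)%:R : R) @[n --> \oo] --> (r`!%:R : R).
Proof.
have f0 : r`!%:R != 0 :> R by rewrite pnatr_eq0 -lt0n fact_gt0.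
rewrite (_ : (fun n => _) = (fun n => r`!%:R * ((n.+1 ^_ r)%N%:R / n.+1%:R ^+ r : R)^-1)).
  rewrite -[X in _ --> X]mulr1; apply: cvgM; first exact: cvg_cst.
  rewrite -[X in _ --> X]invr1; apply: cvgV; [exact: oner_neq0|exact: cvg_ffact_ratio].
apply/funext => n; rewrite -bin_ffact natrM invf_div invfM mulrCA; congr (_ * _).
by rewrite mulrCA mulfV // mulr1.
Qed.

Lemma cvg_div_ratio (R : realType) (m : nat) :
  ((n.+1 %/ m.+1)%N%:R / n.+1%:R : R) @[n --> \oo] --> (m.+1%:R^-1 : R).
Proof.
apply: (@squeeze_cvgr _ _ _ _ (fun n => m.+1%:R^-1 - harmonic n) (fun=> m.+1%:R^-1)).
- near=> n; rewrite /harmonic /=; have n0 : 0 < n.+1%:R :> R by rewrite ltr0n.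
  have m0 : 0 < m.+1%:R :> R by rewrite ltr0n.
  rewrite ler_pdivlMr // ler_pdivrMr // mulrBl mulVf ?gt_eqF //.
  rewrite lerBlDr ![m.+1%:R^-1 * _]mulrC ler_pdivrMr // ler_pdivlMr //.
  rewrite -natr1 -!natrM !natr1 -!natrM !ler_nat leq_trunc_div andbT.
  by rewrite ltnW // ltn_ceil.
- rewrite -[X in _ --> X]subr0.
  by apply: cvgB; [exact: cvg_cst|exact: cvg_harmonic].
- exact: cvg_cst.
Unshelve. all: end_near. Qed.

Local Close Scope classical_set_scope.

Lemma lagrangian_sum_le (R : realType) (r : nat) (G : ugraph r) (x : vertex G -> R) :
  (forall i, 0 <= x i) -> \sum_i x i = 1 ->
  \sum_(e in edges G) \prod_(i in e) x i <= ugraph_lagrangian R G.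
Proof.
move=> x0 x1; apply: ub_le_sup; last by exists x.
by exists 1 => _ [y [y0 y1 ->]]; apply: lagrangian_sum_le1.
Qed.

Lemma ugraph_lagrangian_le1 (R : realType) (r : nat) (G : ugraph r) :
  ugraph_lagrangian R G <= 1.
Proof.
rewrite /ugraph_lagrangian; set S := (fun y : R => _).
(* Without vertices there is no weight vector, and the supremum of the empty set is 0. *)
have [S0|/set0P/negP/negPn/eqP S0] := pselect (S !=set0)%classic.
  by apply: ge_sup => // _ [y [y0 y1 ->]]; apply: lagrangian_sum_le1.
by rewrite S0 sup0.
Qed.

Lemma turan_number_le (R : realType) (r l : nat) (F : ugraph r) (s0 : R) n :
  (0 < l)%N -> s0 < lam R l r ->
  (forall G : ugraph r, family_free (eq F) G ->
    ~ is_colorable (complete_ugraph r l) G ->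
    forall x : vertex G -> R, (forall i, 0 <= x i) -> \sum_i x i = 1 ->
    \sum_(e in edges G) \prod_(i in e) x i <= s0) ->
  (turan_number n (weak_expansions F))%:R <= lam R l r * n%:R ^+ r.
Proof.
move=> l0 s0_lt lag; rewrite /turan_number.
elim/big_ind: _ => [|i j hi hj|D /asboolP free].
- by rewrite mulr_ge0 ?lam_ge0 // exprn_ge0.
- by rewrite /maxn; case: ifP.
have := core_free_card_le l0 s0_lt lag (@card_edge _ (MkUGraph (valP D)))
  (core_free_of_family_free free).
by rewrite /= card_ord.
Qed.

Lemma turan_number_ge (r m : nat) (F : ugraph r) n : #|vertex F| = m.+2 ->
  ('C(m.+1, r) * (n %/ m.+1) ^ r <= turan_number n (weak_expansions F))%N.
Proof.
move=> cF; apply: leq_trans (card_balanced_blowup m n r) _.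
pose D := [set e : {set 'I_n} | (#|e| == r) && (#|@balanced m n @: e| == r)]%SET.
pose E0 : {E : {set {set 'I_n}} | [forall e in E, #|e| == r]} :=
  exist _ D (uniform_set r (fun e => #|@balanced m n @: e| == r)).
have freeE0 : family_free (weak_expansions F) (MkUGraph (valP E0)).
  apply: (blowup_family_free cF); exists (@balanced m n) => e ce.
  by rewrite !inE ce eqxx andbT.
by apply: (leq_bigmax_cond E0); apply/asboolP.
Qed.

Local Open Scope classical_set_scope.

(** Squeezed between the balanced blowup and the edge bound, both valid for every n. *)
Lemma turan_density_eq (R : realType) (r m : nat) (F : ugraph r) (s0 : R) :
  #|vertex F| = m.+2 -> s0 < lam R m.+1 r ->
  (forall G : ugraph r, family_free (eq F) G ->
    ~ is_colorable (complete_ugraph r m.+1) G ->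
    forall x : vertex G -> R, (forall i, 0 <= x i) -> \sum_i x i = 1 ->
    \sum_(e in edges G) \prod_(i in e) x i <= s0) ->
  turan_density R (weak_expansions F) = r`!%:R * lam R m.+1 r.
Proof.
move=> cF s0_lt lag; apply/cvg_lim => //; rewrite -cvg_shiftS /=.
apply: (@squeeze_cvgr _ _ _ _
  (fun n => 'C(m.+1, r)%:R * ((n.+1 %/ m.+1)%N%:R / n.+1%:R) ^+ r * (n.+1%:R ^+ r / 'C(n.+1, r)%:R))
  (fun n => lam R m.+1 r * (n.+1%:R ^+ r / 'C(n.+1, r)%:R))).
- near=> n; have := turan_number_ge n.+1 cF; rewrite -(ler_nat R) natrM natrX => ge.
  have le := turan_number_le n.+1 (ltn0Sn m) s0_lt lag.
  have C0 : 0 <= 'C(n.+1, r)%:R^-1 :> R by rewrite invr_ge0.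
  have n0 : n.+1%:R ^+ r != 0 :> R by rewrite expf_neq0 // pnatr_eq0.
  apply/andP; split; last by rewrite mulrA ler_wpM2r.
  by rewrite mulrA ler_wpM2r // expr_div_n -!mulrA mulVf // mulr1.
- rewrite mulrC -[lam R _ _ * _]/('C(m.+1, r)%:R / _ * _) -exprVn.
  apply: cvgM; last exact: cvg_exp_binomial_ratio.
  apply: cvgM; first exact: cvg_cst.
  exact: (continuous_cvg _ (@exprn_continuous R r _) (@cvg_div_ratio R m)).
- rewrite mulrC; apply: cvgM; [exact: cvg_cst|exact: cvg_exp_binomial_ratio].
Unshelve. all: end_near. Qed.

Local Close Scope classical_set_scope.

Lemma min_vdegree_le (r : nat) (H : ugraph r) (x : vertex H) :
  (min_vdegree H <= vdegree x)%N.
Proof.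
rewrite /min_vdegree; have := mem_index_enum x; elim: index_enum => // y s IHs.
rewrite inE big_cons geq_min => /orP[/eqP->|/IHs->]; rewrite ?leqnn ?orbT //.
Qed.

Theorem theorem1p12 (R : realType) (r l : nat) (r_ge2 : (2 <= r)%N)
    (r_le_l : (r <= l)%N) (F : ugraph r) (vF : #|vertex F| = l.+1)
    (lagrangian_gap :
      sup (fun y : R => exists G : ugraph r,
             [/\ family_free (eq F) G, ~ is_colorable (complete_ugraph r l) G
               & y = ugraph_lagrangian R G])
        < 'C(l, r)%:R / l%:R ^+ r)
    (hF : (exists v : vertex F, isolated_vertex v) \/ is_subgraph F (Bgraph r l.+1)) :
  degree_stable R (weak_expansions F) (blowup_class (complete_ugraph r l)).
Proof.
split; first by move=> H; apply: blowup_family_free.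
case: r r_ge2 r_le_l F vF lagrangian_gap hF => [|[|p]] // _.
case: l => [|m] // pm F vF lagrangian_gap hF; rewrite ltnS in pm.
set s0 := sup _ in lagrangian_gap.
have lag (G : ugraph p.+2) : family_free (eq F) G ->
    ~ is_colorable (complete_ugraph p.+2 m.+1) G ->
    forall x : vertex G -> R, (forall i, 0 <= x i) -> \sum_i x i = 1 ->
    \sum_(e in edges G) \prod_(i in e) x i <= s0.
  move=> free ncol x x0 x1; apply: le_trans (lagrangian_sum_le x0 x1) _.
  apply: ub_le_sup; last by exists G.
  by exists 1 => _ [G' [_ _ ->]]; apply: ugraph_lagrangian_le1.
have [a [T [aT T0 T1 Ta Tna]]] := exists_pivot vF hF pm.
have [eps [delta [eps0 delta0 stable]]] :=
  core_free_degree_stable pm lagrangian_gap lag vF aT T0 T1 Ta Tna.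
(* The threshold exceeds 2/delta, which gives the [2 <= delta * n] used throughout the stability
   argument. *)
exists eps, (Num.truncn (2 / delta)).+1; split=> // H leH free deg_ge.
have large : 2 <= delta * #|vertex H|%:R.
  rewrite mulrC -ler_pdivrMr //; apply: le_trans (ltW (truncnS_gt _)) _.
  by rewrite ler_nat.
have dens : turan_density R (weak_expansions F) / (p.+1)`!%:R = 'C(m, p.+1)%:R / m.+1%:R ^+ p.+1.
  have f0 : (p.+1)`!%:R != 0 :> R by rewrite pnatr_eq0 -lt0n fact_gt0.
  rewrite (turan_density_eq vF lagrangian_gap lag) -lam_degree factS natrM.
  by rewrite [_ * lam _ _ _]mulrAC mulfK.
rewrite /= dens in deg_ge.
have [|chi chiP] := stable _ (edges H) large (@card_edge _ H) (core_free_of_family_free free).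
  by move=> x; apply: le_trans deg_ge _; rewrite ler_nat; exact: min_vdegree_le.
(* The host is the blowup defined by [chi] on the same vertex set; the identity embeds [H] because
   [chi] is injective on its edges. *)
exists (ugraph_of p.+2 (fun e : {set vertex H} => chi @: e \in edges (complete_ugraph p.+2 m.+1))).
  by exists chi => e ce; rewrite inE ce eqxx.
exists id => // e eH; rewrite imset_id inE (card_edge eH) eqxx inE andbT.
rewrite card_in_imset ?(card_edge eH) ?eqxx //; apply: (chiP e eH).
by rewrite disjoint_sym finset.disjoints_subset finset.sub0set.
Qed.
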